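(* Let $B\in\mathbb Z_{\ge1}$, $r,t>0$, and let $\hat S^{(H)}_{t,T}$ be a linear estimator. Then $$\frac{B^2}{6}G(H)\le \sup_{\mu\prec B}\mathbb E\big[|S_{t,T}-\hat S^{(H)}_{t,T}|^2\big]\le B^2G(H),$$ $$\frac{B^2}{34}G(H)\le \sup_{1\prec\mu\prec B}\mathbb E\big[|S_{t,T}-\hat S^{(H)}_{t,T}|^2\big]\le B^2G(H).$$
   Context: Setting (Poissonized generalized unseen species problem). $\mathcal{S}$ is an at most countable set of species and $\mu$ is a probability measure on $2^{\mathcal S}$ supported on finite sets. $t,t'>0$, $r=t'/t$, $T=t+t'=(1+r)t$. Let $X_1,X_2,\dots$ be i.i.d. from $\mu$, and let $n\sim\mathrm{Poisson}(t)$, $m\sim\mathrm{Poisson}(t')$ be independent of each other and of the $X_i$. The first expedition observes $X_1,\dots,X_n$, the second $X_{n+1},\dots,X_{n+m}$. For $s\in\mathcal S$, $N_s$ (resp. $N_s'$) is the number of sets observed in the first (resp. second) expedition that contain $s$. $S_t=|\{s:N_s>0\}|$, $S_T=|\{s:N_s+N_s'>0\}|$, $S_{t,T}=S_T-S_t$. $\mu\prec B$ means $\mu(A)=0$ whenever $|A|>B$; $1\prec\mu$ means additionally $\mu(\emptyset)=0$. Suprema range over all such $\mu$ on all at most countable species sets $\mathcal S$. A linear estimator is one of the form $\hat S^{(H)}_{t,T}=\sum_{s\in\mathcal S}H(N_s)$ for a function $H:\mathbb Z_{\ge0}\to\mathbb R$ with $H(0)=0$ (which may depend on $r$ and $t$);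 write $H_i=H(i)$. Let $g_H(x)=\sum_{i=1}^\infty\frac{H_i}{i!}x^i$, and let $H^2$ be the element-wise square of $H$. Define $$Y_b=\Big(\max_{p\in[0,1]}\frac{e^{-pt}}{p}\big|1-e^{-rpt}-g_H(pt)\big|\Big)^2,\qquad Y_v=\max_{q\in[0,1]}\frac{e^{-qt}}{q}\big(1-e^{-rqt}+g_{H^2}(qt)\big),\qquad G(H)=Y_b+Y_v,$$ where both expressions are extended continuously at zero (values $t|r-H_1|$ at $p=0$ and $t(r+H_1^2)$ at $q=0$), and $G(H)=+\infty$ if $\sum_{i\ge1}H_i^2t^i/i!=\infty$. *)

(* Defs.v *)
(* MathComp-Analysis. *)
From HB Require Import structures.
From mathcomp Require Import all_boot all_order all_algebra finmap.
From mathcomp Require Import all_classical all_reals all_analysis.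

Set Implicit Arguments.
Unset Strict Implicit.
Unset Printing Implicit Defensive.

Import Order.TTheory GRing.Theory Num.Theory.
Import numFieldNormedType.Exports.

Local Open Scope classical_set_scope.
Local Open Scope ring_scope.

(* A probability measure on 2^S supported on finite sets is a probability
   measure on the countable type {fset S} with its discrete sigma-algebra. *)
HB.instance Definition _ (S : countType) :=
  @isMeasurable.Build default_measure_display {fset S} discrete_measurable
    discrete_measurable0 discrete_measurableC discrete_measurableU.

(* Mutual independence of a family of collections of events. *)
Definition mutually_independent d (T : measurableType d) (R : realType)
    (P : probability T R) (I : choiceType) (F : I -> set (set T)) : Prop :=
  forall (J : {fset I}) (E : I -> set T), (forall i, i \in J -> F i (E i)) ->
  P (\bigcap_(i in [set` J]) E i) = (\prod_(i <- J) P (E i))%E.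

(* The sigma-algebra generated by X. *)
Definition events_of d d' (T : measurableType d) (T' : measurableType d')
    (X : T -> T') : set (set T) := [set X @^-1` A | A in measurable].

(* The Poissonized experiment. The draws are indexed from 0: the first
   expedition observes draw i for i < n, the second for n <= i < n + m. *)
Record experiment (R : realType) (S : countType)
    (mu : probability {fset S} R) (t t' : R)
    d (Omega : measurableType d) (P : probability Omega R) := Experiment {
  draw : nat -> {RV P >-> {fset S}} ;
  size1 : {RV P >-> nat} ;
  size2 : {RV P >-> nat} ;
  draw_law : forall i (A : set {fset S}), P (draw i @^-1` A) = mu A ;
  size1_law : forall k, P (size1 @^-1` [set k]) = (poisson_pmf t k)%:E ;
  size2_law : forall k, P (size2 @^-1` [set k]) = (poisson_pmf t' k)%:E ;
  experiment_indep : mutually_independent P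
    (fun j : nat + bool => match j with
                           | inl i => events_of (draw i)
                           | inr true => events_of size1
                           | inr false => events_of size2
                           end)
}.

Section observables.
Context (R : realType) (S : countType) (mu : probability {fset S} R) (t t' : R).
Context d (Omega : measurableType d) (P : probability Omega R).
Variable e : experiment mu t t' P.

(* N_s *)
Definition count1 (s : S) (w : Omega) : nat :=
  (\sum_(0 <= i < size1 e w) (s \in draw e i w))%N.

(* N'_s *)
Definition count2 (s : S) (w : Omega) : nat :=
  (\sum_(size1 e w <= i < size1 e w + size2 e w) (s \in draw e i w))%N.

(* S_t *)
Definition seen1 (w : Omega) : nat :=
  #|` fset_set [set s | (0 < count1 s w)%N]|.

(* S_T *)
Definition seen12 (w : Omega) : nat :=
  #|` fset_set [set s | (0 < count1 s w + count2 s w)%N]|.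

(* S_{t,T} *)
Definition newly_seen (w : Omega) : R := (seen12 w)%:R - (seen1 w)%:R.

(* All but finitely many terms are H 0, which is 0 for a linear estimator. *)
Definition linear_estimator (H : nat -> R) (w : Omega) : R :=
  \sum_(s \in [set: S]) H (count1 s w).

Definition risk (H : nat -> R) : \bar R :=
  'E_P[fun w => `|newly_seen w - linear_estimator H w| ^+ 2].

End observables.

Definition size_le (B : nat) (R : realType) (S : countType)
    (mu : probability {fset S} R) : Prop :=
  forall A : {fset S}, (B < #|` A|)%N -> mu [set A] = 0%E.

Definition size_ge1_le (B : nat) (R : realType) (S : countType)
    (mu : probability {fset S} R) : Prop :=
  mu [set fset0] = 0%E /\ size_le B mu.

(* The supremum of the risk over all countable species sets and all mu on them
   satisfying C. The risk depends on mu only, not on the realization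
   (Omega, P, e) of the experiment. *)
Definition sup_risk (R : realType)
    (C : forall S : countType, probability {fset S} R -> Prop)
    (t t' : R) (H : nat -> R) : \bar R :=
  ereal_sup [set x | exists (S : countType) (mu : probability {fset S} R)
      (d : measure_display) (Omega : measurableType d)
      (P : probability Omega R) (e : experiment mu t t' P),
    C S mu /\ x = risk e H].

Section G_functional.
Context (R : realType).
Implicit Types (r t x p q : R) (H : nat -> R).

Definition egf H x : R :=
  \big[+%R/0]_(1 <= i <oo) (H i / i`!%:R * x ^+ i).

(* The branches at 0 below are the continuous extensions. *)
Definition bias_profile r t H p : R :=
  if p == 0 then t * `|r - H 1%N|
  else expR (- (p * t)) / p
       * `|1 - expR (- (r * p * t)) - egf H (p * t)|.

Definition variance_profile r t H q : R :=
  if q == 0 then t * (r + H 1%N ^+ 2)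
  else expR (- (q * t)) / q
       * (1 - expR (- (r * q * t)) + egf (fun i => H i ^+ 2) (q * t)).

(* The maxima over [0, 1] are taken as suprema in \bar R: when
   \sum_i H_i^2 t^i / i! is finite the profiles are continuous on [0, 1] and the
   two agree; otherwise G below does not use them. *)
Definition Yb r t H : \bar R :=
  (ereal_sup [set (bias_profile r t H p)%:E | p in `[0%R, 1%R]] ^+ 2)%E.

Definition Yv r t H : \bar R :=
  ereal_sup [set (variance_profile r t H q)%:E | q in `[0%R, 1%R]].

Definition G r t H : \bar R :=
  (if \sum_(1 <= i <oo) (H i ^+ 2 * t ^+ i / i`!%:R)%:E == +oo then +oo
   else Yb r t H + Yv r t H)%E.

End G_functional.

(* Main.v *)
Require Import Defs.
From HB Require Import structures.
From mathcomp Require Import all_boot all_order all_algebra finmap.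
From mathcomp Require Import all_classical all_reals all_analysis.
From mathcomp Require Import measurable_realfun ring lra.

(** Write Z_s for the contribution of the species s to the error: 1 if s is
    seen in the second expedition only, and - H (N_s) if it is seen in the
    first one. If a random set contains s with probability p then the two counts
    of s are independent Poisson variables of parameters p t and p r t, so that
    E[Z_s] = m p and E[Z_s ^ 2] = sigma p, where |m p| = p * bias_profile p and
    sigma p = p * variance_profile p (mean_profile and second_profile below).

    Upper bound. Since the sets have at most B elements, the probabilities of
    the species add up to at most B, so that the mean of the error is at most
    B * sqrt Yb and the second moments E[Z_s ^ 2] add up to at most B * Yv. What
    remains is Var (sum_s Z_s) <= B * sum_s Var Z_s, although the counts of
    species that occur together are dependent. The Poissonized experiment is
    the limit, as M grows, of M slots that each hold a draw with probability
    t / M (respectively r t / M). For functions of finitely many independent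
    slots such a comparison of variances tensorizes (variance_tensorization),
    so that one slot suffices; there Z_s is an affine function of the indicator
    of s, and Cauchy-Schwarz over the at most B species of the set concludes
    (set_variance_le), up to a factor that tends to 1. The passage to the limit
    rests on a one-sided comparison of binomial with Poisson weights, applied to
    a bounded function and to its complement (cvg_slot_avg). Fatou's lemma
    then removes the restrictions to finitely many species and to finitely
    supported H (risk_le).

    Lower bounds. Take disjoint blocks of B species each, where a draw is block
    number i with probability p_i. The species of a block contribute equally,
    distinct blocks are asymptotically uncorrelated (set_variance_ge), and the
    risk is at least B ^ 2 times
      (sum_i m (p_i)) ^ 2 + sum_i (sigma (p_i) - m (p_i) ^ 2)
    (block_second_moment). With floor (1 / p) blocks of probability p, and the
    empty set for the remaining mass, this yields both profiles at p up to
    constants (subprob_bounds). If the empty set is excluded, the remaining mass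
    is spread over a growing number of rare blocks; their total mean converges
    to a multiple of the derivative of m at 0, which is itself controlled by the
    risk of a design with rare blocks only (prob_bounds).

    The suprema of the risk range over realizations of the experiment, so the
    lower bounds also need a probability space that carries the draws. The
    i.i.d. sequence is the itinerary of a uniform point of [0, 1[ under a
    piecewise affine expanding map (samples_law). *)

Set Implicit Arguments.
Unset Strict Implicit.
Unset Printing Implicit Defensive.

Import Order.TTheory GRing.Theory Num.Theory.
Import numFieldNormedType.Exports.

Local Open Scope classical_set_scope.
Local Open Scope ring_scope.

(** The counts of a species in the two expeditions are kept as a pair; the
    boolean true stands for the first expedition throughout. *)
Definition add_count b (k : nat) (y : nat * nat) : nat * nat :=
  if b then (k + y.1, y.2)%N else (y.1, k + y.2)%N.

(** * Averages over finitely many independent draws *)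

Section averages.
Context (R : realFieldType) (I : finType).
Implicit Types (w : bool -> {set I} -> R) (l : seq bool) (x : I -> nat * nat).
Implicit Types (Phi Psi : (I -> nat * nat) -> R) (p : bool -> R) (f : nat * nat -> R).

Definition add_draw b (J : {set I}) x : I -> nat * nat :=
  fun s => add_count b (s \in J) (x s).

(** Draws are encoded by their effect on expectations: if the weights w b are
    those of a probability on {set I}, then avg w l Phi x is the expected value
    of Phi at the counts x updated by independent draws, one for each entry of l. *)
Fixpoint avg w l Phi x : R :=
  if l is b :: l' then \sum_(J : {set I}) w b J * avg w l' Phi (add_draw b J x) else Phi x.

(** The same average seen from one species, which a draw contains with
    probability p b; see avg_coord. *)
Fixpoint species_avg p l f y : R :=
  if l is b :: l' then (1 - p b) * species_avg p l' f y + p b * species_avg p l' f (add_count b 1 y)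
  else f y.

Definition marginal w (s : I) b : R := \sum_(J : {set I} | s \in J) w b J.

Definition weights w := forall b, (forall J, 0 <= w b J) /\ \sum_(J : {set I}) w b J = 1.

Lemma avg_cat w l1 l2 Phi x : avg w (l1 ++ l2) Phi x = avg w l1 (avg w l2 Phi) x.
Proof.
by elim: l1 x => //= b l1 IH x; apply: eq_bigr => J _; rewrite IH.
Qed.

Lemma species_avg_cat p l1 l2 f y : species_avg p (l1 ++ l2) f y = species_avg p l1 (species_avg p l2 f) y.
Proof. by elim: l1 y => //= b l1 IH y; rewrite !IH. Qed.

Lemma eq_avg w l Phi Psi x : Phi =1 Psi -> avg w l Phi x = avg w l Psi x.
Proof.
by move=> e; elim: l x => //= b l IH x; apply: eq_bigr => J _; rewrite IH.
Qed.

Lemma eq_species_avg p l f g y : f =1 g -> species_avg p l f y = species_avg p l g y.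
Proof. by move=> e; elim: l y => //= b l IH y; rewrite !IH. Qed.

Lemma avg_le w l Phi Psi x : weights w -> (forall x, Phi x <= Psi x) ->
  avg w l Phi x <= avg w l Psi x.
Proof.
move=> ww e; elim: l x => //= b l IH x; apply: ler_sum => J _.
by rewrite ler_wpM2l ?IH//; case: (ww b).
Qed.

Lemma avgZ w l c Phi x : avg w l (fun x => c * Phi x) x = c * avg w l Phi x.
Proof.
elim: l x => //= b l IH x; rewrite mulr_sumr; apply: eq_bigr => J _.
by rewrite IH mulrCA.
Qed.

Lemma avgD w l Phi Psi x :
  avg w l (fun x => Phi x + Psi x) x = avg w l Phi x + avg w l Psi x.
Proof.
elim: l x => //= b l IH x; rewrite -big_split; apply: eq_bigr => J _.
by rewrite IH mulrDr.
Qed.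

Lemma avg_sum w l n (F : 'I_n -> (I -> nat * nat) -> R) x :
  avg w l (fun x => \sum_k F k x) x = \sum_k avg w l (F k) x.
Proof.
elim: l x => //= b l IH x; rewrite exchange_big; apply: eq_bigr => J _.
by rewrite IH mulr_sumr.
Qed.

Lemma avg_cst w l c x : weights w -> avg w l (fun=> c) x = c.
Proof.
move=> ww; elim: l x => //= b l IH x.
under eq_bigr do rewrite IH.
by rewrite -mulr_suml (ww b).2 mul1r.
Qed.

Lemma sum_marginal w b (d : I -> R) :
  \sum_(J : {set I}) w b J * (\sum_(s in J) d s) = \sum_s marginal w s b * d s.
Proof.
under eq_bigr do rewrite mulr_sumr big_mkcond /=.
rewrite exchange_big /=; apply: eq_bigr => s _.
rewrite /marginal mulr_suml [RHS]big_mkcond /=.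
by apply: eq_bigr => J _; case: ifP.
Qed.

Lemma marginalC w s b : weights w ->
  \sum_(J : {set I} | s \notin J) w b J = 1 - marginal w s b.
Proof.
move=> ww; apply/eqP; rewrite eq_sym subr_eq -(ww b).2.
by rewrite [eqbLHS](bigID (fun J : {set I} => s \in J))/= addrC.
Qed.

Lemma marginal_ge0 w s b : weights w -> 0 <= marginal w s b.
Proof. by move=> ww; apply: sumr_ge0 => J _; case: (ww b). Qed.

Lemma marginal_le1 w s b : weights w -> marginal w s b <= 1.
Proof.
move=> ww; rewrite -subr_ge0 -marginalC//.
by apply: sumr_ge0 => J _; case: (ww b).
Qed.

Lemma add_count0 b y : add_count b 0 y = y.
Proof. by rewrite /add_count; case: b y => -[]. Qed.

Lemma sum_add_draw w b s f x : weights w ->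
  \sum_(J : {set I}) w b J * f (add_draw b J x s) =
  (1 - marginal w s b) * f (x s) + marginal w s b * f (add_count b 1 (x s)).
Proof.
move=> ww; rewrite (bigID (fun J : {set I} => s \in J))/= addrC; congr (_ + _).
  rewrite -marginalC// mulr_suml; apply: eq_bigr => J /negPf sJ.
  by rewrite /add_draw sJ add_count0.
by rewrite mulr_suml; apply: eq_bigr => J sJ; rewrite /add_draw sJ.
Qed.

Lemma avg_coord w l s f x : weights w ->
  avg w l (fun x => f (x s)) x = species_avg (marginal w s) l f (x s).
Proof.
move=> ww; elim: l x => //= b l IH x.
under eq_bigr do rewrite IH.
by rewrite sum_add_draw.
Qed.

Definition set_variance (v : {set I} -> R) (d : I -> R) : R :=
  \sum_(J : {set I}) v J * (\sum_(s in J) d s) ^+ 2 - (\sum_(J : {set I}) v J * (\sum_(s in J) d s)) ^+ 2.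

(** Conditioning on the first draw splits both sides by the law of total
    variance. The mean of the conditional variances is handled by induction. The
    variance of the conditional mean involves, for each species s, a function of
    one indicator only, which is affine in that indicator: this is why the
    hypothesis on linear statistics of a single draw is enough. The sign of k
    selects an upper or a lower bound. *)
Lemma variance_tensorization w (k C : R) : weights w ->
  (forall b d, k * set_variance (w b) d <=
     C * \sum_s marginal w s b * (1 - marginal w s b) * d s ^+ 2) ->
  forall l (f : I -> nat * nat -> R) x,
  k * (avg w l (fun x => (\sum_s f s (x s)) ^+ 2) x
       - (\sum_s species_avg (marginal w s) l (f s) (x s)) ^+ 2) <=
  C * \sum_s (species_avg (marginal w s) l (fun y => f s y ^+ 2) (x s)
              - species_avg (marginal w s) l (f s) (x s) ^+ 2).
Proof.
move=> ww one l f; elim: l => [|b l IH] x /=.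
  by rewrite subrr mulr0 big1 ?mulr0// => s _; rewrite subrr.
(* g and q are the conditional first and second moments after the first draw, and
   d is the effect on g of meeting s in it *)
pose g s y := species_avg (marginal w s) l (f s) y.
pose q s y := species_avg (marginal w s) l (fun y => f s y ^+ 2) y.
pose d s := g s (add_count b 1 (x s)) - g s (x s).
have gE J s : g s (add_draw b J x s) = g s (x s) + (s \in J)%:R * d s.
  rewrite /add_draw /d; case: (s \in J); last by rewrite add_count0 mul0r addr0.
  by rewrite mul1r addrC subrK.
have gJ J : \sum_s g s (add_draw b J x s) = \sum_s g s (x s) + \sum_(s in J) d s.
  under eq_bigr do rewrite gE.
  rewrite big_split/=; congr (_ + _); rewrite [RHS]big_mkcond.
  by apply: eq_bigr => s _; case: ifP => _; rewrite ?mul1r ?mul0r.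
set a := \sum_s g s (x s) in gJ.
have H1 : \sum_(J : {set I}) w b J * (\sum_s g s (add_draw b J x s)) ^+ 2
    - (\sum_s ((1 - marginal w s b) * g s (x s) +
               marginal w s b * g s (add_count b 1 (x s)))) ^+ 2
    = set_variance (w b) d.
  rewrite /set_variance.
  have -> : \sum_s ((1 - marginal w s b) * g s (x s) +
               marginal w s b * g s (add_count b 1 (x s)))
      = a + \sum_(J : {set I}) w b J * \sum_(s in J) d s.
    rewrite sum_marginal /a -big_split; apply: eq_bigr => s _.
    by rewrite /d/=; ring.
  under eq_bigr do rewrite gJ sqrrD mulrDr mulrDr.
  rewrite !big_split/= -mulr_suml (ww b).2 mul1r.
  have -> : \sum_(J : {set I}) w b J * (a * (\sum_(s in J) d s) *+ 2) =
      a * (\sum_(J : {set I}) w b J * \sum_(s in J) d s) *+ 2.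
    rewrite mulr_sumr -sumrMnl; apply: eq_bigr => J _.
    by rewrite !mulr2n; ring.
  by rewrite !mulr2n; ring.
have H2 : \sum_(J : {set I}) w b J * \sum_s (q s (add_draw b J x s) - g s (add_draw b J x s) ^+ 2)
  + \sum_s marginal w s b * (1 - marginal w s b) * d s ^+ 2
  = \sum_s (((1 - marginal w s b) * q s (x s) + marginal w s b * q s (add_count b 1 (x s)))
    - ((1 - marginal w s b) * g s (x s) + marginal w s b * g s (add_count b 1 (x s))) ^+ 2).
  under eq_bigr do rewrite mulr_sumr.
  rewrite exchange_big -big_split; apply: eq_bigr => s _.
  rewrite (sum_add_draw _ _ (fun y => q s y - g s y ^+ 2))// /d/=; ring.
set m := (X in _ - X ^+ 2 = _) in H1.
set e := (X in _ = X) in H2.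
set X := (X in X - _ = _) in H1.
change (k * (\sum_J w b J * avg w l (fun x => (\sum_s f s (x s)) ^+ 2) (add_draw b J x)
  - m ^+ 2) <= C * e).
set A := (X in k * (X - _)).
have -> : A - m ^+ 2 = (A - X) + set_variance (w b) d by rewrite -H1; ring.
rewrite -H2 [leLHS]mulrDr [leRHS]mulrDr; apply: lerD; last exact: one.
rewrite /A /X -sumrB !mulr_sumr ler_sum// => J _.
rewrite -mulrBr mulrCA [leRHS]mulrCA ler_wpM2l//.
by case: (ww b).
Qed.

End averages.

(** * Lazy draws and binomial weights *)

Section lazy_weights.
Context (R : realType) (I : finType).
Implicit Types (v : {set I} -> R) (tau : bool -> R) (x : I -> nat * nat).
Implicit Types (Phi : (I -> nat * nat) -> R) (p : bool -> R).

(** The empty set leaves all counts unchanged, so it also encodes a slot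
    without a draw. *)
Definition lazy_weights tau v b (J : {set I}) : R :=
  (1 - tau b) * (J == finset.set0)%:R + tau b * v J.

Definition binomial_weight (a : R) M j : R := 'C(M, j)%:R * a ^+ j * (1 - a) ^+ (M - j).

Lemma sum_lazy_weights tau v b (F : {set I} -> R) :
  \sum_J lazy_weights tau v b J * F J =
  (1 - tau b) * F finset.set0 + tau b * \sum_J v J * F J.
Proof.
under eq_bigr do rewrite mulrDl.
rewrite big_split/=; congr (_ + _).
  rewrite (bigD1 finset.set0)//= big1 ?addr0 ?eqxx ?mulr1//.
  by move=> J /negPf ->; rewrite mulr0 mul0r.
by rewrite mulr_sumr; apply: eq_bigr => J _; rewrite mulrA.
Qed.

Lemma weights_lazy_weights tau v : (forall b, 0 <= tau b <= 1) ->
  weights (fun=> v) -> weights (lazy_weights tau v).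
Proof.
move=> t01 wv b; have /andP[t0 t1] := t01 b; split=> [J|].
  rewrite addr_ge0// mulr_ge0// ?subr_ge0//; exact: (wv true).1.
under eq_bigr do rewrite -[lazy_weights _ _ _ _]mulr1.
rewrite sum_lazy_weights mulr1; under eq_bigr do rewrite mulr1.
by rewrite (wv true).2; ring.
Qed.

Lemma marginal_lazy_weights tau v s b :
  marginal (lazy_weights tau v) s b = tau b * marginal (fun=> v) s b.
Proof.
rewrite /marginal mulr_sumr; apply: eq_bigr => J sJ; rewrite /lazy_weights.
have /negPf -> : J != finset.set0 by apply: contraTN sJ => /eqP ->; rewrite inE.
by rewrite mulr0 add0r.
Qed.

(** Pascal's rule, in the form needed to add one slot. *)
Lemma binomial_weightS a M (u : nat -> R) :
  (1 - a) * \sum_(j < M.+1) binomial_weight a M j * u j +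
    a * \sum_(j < M.+1) binomial_weight a M j * u j.+1 =
  \sum_(j < M.+2) binomial_weight a M.+1 j * u j.
Proof.
have e : \sum_(j < M.+1) binomial_weight a M j * u j = \sum_(j < M.+2) binomial_weight a M j * u j.
  by rewrite [RHS]big_ord_recr /= {3}/binomial_weight bin_small// !mul0r addr0.
rewrite e big_ord_recl [RHS]big_ord_recl/= mulrDr -addrA; congr (_ + _).
  by rewrite /binomial_weight !bin0 !expr0 !mul1r !subn0 exprS mulrA.
rewrite !mulr_sumr -big_split; apply: eq_bigr => -[j jM] _/=.
rewrite /bump add1n /binomial_weight binS natrD subSS.
case: (leqP M j) => jM'.
  have -> : j = M by apply/eqP; rewrite eqn_leq jM' -ltnS jM.
  by rewrite bin_small// subnn binn exprS; ring.
have -> : (M - j = (M - j.+1).+1)%N by rewrite subnSK.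
by rewrite !exprS; ring.
Qed.

Lemma add_draw_set0 b x : add_draw b finset.set0 x = x.
Proof. by apply/funext => s; rewrite /add_draw inE add_count0. Qed.

Lemma avg_lazy_weights_nseq tau v b M Phi x :
  avg (lazy_weights tau v) (nseq M b) Phi x =
  \sum_(j < M.+1) binomial_weight (tau b) M j * avg (fun=> v) (nseq j b) Phi x.
Proof.
elim: M x => [|M IH] x /=.
  by rewrite big_ord1 /binomial_weight bin0 expr0 subn0 expr0 !mul1r.
rewrite sum_lazy_weights add_draw_set0.
rewrite -(binomial_weightS _ _ (fun j => avg (fun=> v) (nseq j b) Phi x)) IH/=.
congr (_ + _ * _); under eq_bigr do rewrite IH mulr_sumr.
rewrite exchange_big; apply: eq_bigr => j _ /=.
by rewrite mulr_sumr; apply: eq_bigr => J _; rewrite mulrCA.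
Qed.

Lemma species_avg_nseq p b M f y :
  species_avg p (nseq M b) f y = \sum_(j < M.+1) binomial_weight (p b) M j * f (add_count b j y).
Proof.
elim: M y => [|M IH] y /=.
  by rewrite big_ord1 /binomial_weight bin0 expr0 subn0 expr0 !mul1r add_count0.
rewrite -(binomial_weightS _ _ (fun j => f (add_count b j y))) !IH; congr (_ + _ * _).
apply: eq_bigr => j _; congr (_ * f _).
by rewrite /add_count; case: (b); rewrite /= addnA addn1.
Qed.

Definition slots M : seq bool := nseq M true ++ nseq M false.

Lemma avg_slots tau v M Phi x :
  avg (lazy_weights tau v) (slots M) Phi x =
  \sum_(j < M.+1) \sum_(k < M.+1) binomial_weight (tau true) M j * binomial_weight (tau false) M k *
    avg (fun=> v) (nseq j true ++ nseq k false) Phi x.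
Proof.
rewrite avg_cat avg_lazy_weights_nseq; apply: eq_bigr => j _.
rewrite (eq_avg _ _ _ (avg_lazy_weights_nseq tau v false M Phi)) avg_sum mulr_sumr.
by apply: eq_bigr => k _; rewrite avgZ avg_cat mulrA.
Qed.

End lazy_weights.

Lemma cvg_sumr (R : realType) (J : finType) (F : J -> nat -> R) (l : J -> R) :
  (forall j, F j M @[M --> \oo] --> l j) ->
  \sum_j F j M @[M --> \oo] --> \sum_j l j.
Proof. by move=> h; apply: (cvg_big add_continuous) => j _; exact: h. Qed.

(** * Binomial against Poisson weights *)

Section poisson_weights.
Context (R : realType).
Implicit Types (x z : R).

(** Unlike poisson_pmf, this is also the Poisson weight at rate 0, the rate
    of a species that is never drawn. *)
Definition poisson_weight x j : R := expR (- x) * x ^+ j / j`!%:R.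

Lemma poisson_weight_ge0 x j : 0 <= x -> 0 <= poisson_weight x j.
Proof. by move=> x0; rewrite /poisson_weight divr_ge0// mulr_ge0 ?expR_ge0// exprn_ge0. Qed.

Lemma poisson_pmfE x j : 0 < x -> poisson_pmf x j = poisson_weight x j.
Proof. by move=> x0; rewrite /poisson_pmf x0 /poisson_weight; ring. Qed.

Lemma sum_poisson_weight x z N : \sum_(j < N) poisson_weight x j * z ^+ j =
  expR (- x) * series (exp_coeff (x * z)) N.
Proof.
rewrite /series/= big_mkord mulr_sumr; apply: eq_bigr => j _.
by rewrite /poisson_weight /exp_coeff/= exprMn; ring.
Qed.

Lemma cvg_sum_poisson_weight x z :
  (fun N => \sum_(j < N) poisson_weight x j * z ^+ j) @ \oo --> expR (x * (z - 1)).
Proof.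
under eq_fun do rewrite sum_poisson_weight.
rewrite mulrBr mulr1 addrC expRD; apply: cvgMl_tmp.
exact: is_cvg_series_exp_coeff.
Qed.

Lemma sum_poisson_weight_le x z N : 0 <= x -> 0 <= z ->
  \sum_(j < N) poisson_weight x j * z ^+ j <= expR (x * (z - 1)).
Proof.
move=> x0 z0; rewrite -(cvg_lim _ (cvg_sum_poisson_weight (x := x) (z := z)))//.
apply: (nondecreasing_cvgn_le _ (cvgP _ (cvg_sum_poisson_weight (x := x) (z := z)))).
apply/nondecreasing_seqP => n; rewrite big_ord_recr/= lerDl.
by rewrite mulr_ge0 ?poisson_weight_ge0// exprn_ge0.
Qed.

Lemma bin_fact_le M j : ('C(M, j) * j`! <= M ^ j)%N.
Proof.
rewrite bin_ffact; elim: j M => [|j IH] M; first by rewrite ffactn0.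
rewrite ffactnS expnS leq_mul2l; apply/orP; right.
by apply: (leq_trans (IH _)); case: j {IH} => // j; rewrite leq_exp2r// leq_pred.
Qed.

Lemma binomial_weight_ge0 x M j : 0 <= x <= 1 -> 0 <= binomial_weight x M j.
Proof.
by move=> /andP[x0 x1]; rewrite /binomial_weight !mulr_ge0 ?exprn_ge0 ?subr_ge0.
Qed.

(** The bounds 'C(M, j) * j`! <= M ^ j and 1 - y <= exp (- y) give the Poisson
    weight up to the factor exp (x / M) ^ j, whose Poisson mean tends to 1. As
    both families of weights have total mass 1, this one-sided inequality is all
    that the convergence results need. *)
Lemma binomial_weight_le x M j : 0 <= x <= M%:R -> (0 < M)%N -> (j <= M)%N ->
  binomial_weight (x / M%:R) M j <= poisson_weight x j * expR (x / M%:R) ^+ j.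
Proof.
move=> /andP[x0 xM] M0 jM.
have M0' : 0 < M%:R :> R by rewrite ltr0n.
have h1 : (1 - x / M%:R) ^+ (M - j) <= expR (- x) * expR (x / M%:R) ^+ j.
  have -> : expR (- x) * expR (x / M%:R) ^+ j = expR (- (x / M%:R)) ^+ (M - j).
    rewrite -!expRM_natl -expRD; congr expR; rewrite natrB//.
    by field; rewrite gt_eqF.
  apply: lerXn2r; rewrite ?nnegrE ?expR_ge0 ?subr_ge0 ?ler_pdivrMr ?mul1r//.
  exact: expR_ge1Dx.
have h2 : 'C(M, j)%:R * (x / M%:R) ^+ j <= x ^+ j / j`!%:R.
  rewrite ler_pdivlMr ?ltr0n ?fact_gt0// expr_div_n.
  rewrite (_ : _ * _ * _ = x ^+ j * (('C(M, j) * j`!)%:R / M%:R ^+ j)); last first.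
    by rewrite natrM; ring.
  rewrite ler_piMr ?exprn_ge0// ler_pdivrMr ?exprn_gt0// mul1r -natrX ler_nat.
  exact: bin_fact_le.
rewrite /binomial_weight (_ : poisson_weight x j * _ =
  x ^+ j / j`!%:R * (expR (- x) * expR (x / M%:R) ^+ j)); last first.
  by rewrite /poisson_weight; ring.
by apply: ler_pM => //; rewrite ?mulr_ge0 ?exprn_ge0 ?divr_ge0// subr_ge0
  ler_pdivrMr ?mul1r.
Qed.

Lemma sum_binomial_weight x M : \sum_(j < M.+1) binomial_weight x M j = 1.
Proof.
have := exprDn (1 - x) x M; rewrite subrK expr1n => ->.
by apply: eq_bigr => j _; rewrite /binomial_weight -mulr_natl; ring.
Qed.

Lemma cvg_expR_div x : (fun M : nat => expR (x / M%:R)) @ \oo --> (1 : R).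
Proof.
rewrite -[X in _ --> X]expR0.
apply: (@continuous_cvg _ _ _ _ _ (fun M : nat => x / M%:R) expR 0).
  exact: continuous_expR.
rewrite -[X in _ --> X](mulr0 x); apply: cvgMl_tmp.
apply/(@gtr0_cvgV0 R _ \oo _ (fun M : nat => M%:R)); last exact: cvgr_idn.
by near=> M; rewrite ltr0n; near: M; exists 1%N.
Unshelve. all: by end_near. Qed.

(** The exponential moment is the Poisson mean of the factors
    exp (x / M) ^ j from binomial_weight_le. *)
Lemma cvg_expR_tilt x :
  (fun M : nat => expR (x * (expR (x / M%:R) - 1))) @ \oo --> (1 : R).
Proof.
rewrite -[X in _ --> X]expR0.
apply: (@continuous_cvg _ _ _ _ _
  (fun M : nat => x * (expR (x / M%:R) - 1)) expR 0).
  exact: continuous_expR.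
rewrite -[X in _ --> X](mulr0 x); apply: cvgMl_tmp.
rewrite -[X in _ --> X](subrr 1); apply: cvgB; [exact: cvg_expR_div|exact: cvg_cst].
Qed.

Lemma cvg_binomial_weight x j : 0 <= x ->
  (fun M => binomial_weight (x / M%:R) M j) @ \oo --> poisson_weight x j.
Proof.
move=> x0.
apply: (@squeeze_cvgr _ _ _ _
  (fun M : nat => 1 - expR (x * (expR (x / M%:R) - 1)) + poisson_weight x j)
  (fun M : nat => poisson_weight x j * expR (x / M%:R) ^+ j)).
- near=> M.
  have M0 : (0 < M)%N by near: M; exists 1%N.
  have M0' : 0 < M%:R :> R by rewrite ltr0n.
  have jM : (j < M.+1)%N by near: M; exists j => // n /=; rewrite ltnS.
  have xM : 0 <= x <= M%:R by rewrite x0/=; near: M; exact: nbhs_infty_ger.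
  apply/andP; split; last exact: binomial_weight_le.
  set z := expR (x / M%:R).
  have z1 : 1 <= z by rewrite -expR0 ler_expR divr_ge0.
  have := sum_binomial_weight (x / M%:R) M; rewrite (bigD1 (Ordinal jM))//=.
  have h : \sum_(i < M.+1 | i != Ordinal jM) binomial_weight (x / M%:R) M i
      + poisson_weight x j * z ^+ j <= expR (x * (z - 1)).
    apply: le_trans (@sum_poisson_weight_le x z M.+1 x0 _); last by rewrite expR_ge0.
    rewrite addrC [leRHS](bigD1 (Ordinal jM))//= lerD2l.
    by apply: ler_sum => i _; rewrite binomial_weight_le// -ltnS.
  have : poisson_weight x j <= poisson_weight x j * z ^+ j by rewrite ler_peMr ?poisson_weight_ge0// exprn_ege1.
  by lra.
- rewrite -[X in _ --> X]add0r; apply: cvgD; last exact: cvg_cst.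
  rewrite -[X in _ --> X](subrr 1); apply: cvgB; [exact: cvg_cst|].
  exact: cvg_expR_tilt.
- rewrite -[X in _ --> X]mulr1; apply: cvgMl_tmp.
  rewrite -[X in _ --> X](expr1n _ j).
  apply: (@continuous_cvg _ _ _ _ _
    (fun M : nat => expR (x / M%:R)) (fun y : R => y ^+ j) 1).
    exact: exprn_continuous.
  exact: cvg_expR_div.
Unshelve. all: by end_near. Qed.

End poisson_weights.

(** * Variance of a single draw *)

Section one_step.
Context (R : realType) (I : finType).
Implicit Types (v : {set I} -> R) (d : I -> R) (tau : bool -> R).

(** Cauchy-Schwarz. *)
Lemma sqr_sum_le (J : {set I}) d (n : nat) : (#|J| <= n)%N ->
  (\sum_(s in J) d s) ^+ 2 <= n%:R * \sum_(s in J) d s ^+ 2.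
Proof.
move=> Jn; apply: (@le_trans _ _ (#|J|%:R * \sum_(s in J) d s ^+ 2)); last first.
  by rewrite ler_wpM2r ?ler_nat// sumr_ge0// => s _; rewrite sqr_ge0.
have [J0|J0] := eqVneq #|J| 0%N.
  by rewrite (cards0_eq J0) !big_set0 mulr0 expr0n.
set m := #|J| in J0 *; set S1 := \sum_(s in J) d s; set S2 := \sum_(s in J) _.
have m0 : 0 < m%:R :> R by rewrite ltr0n lt0n.
have : 0 <= \sum_(s in J) (m%:R * d s - S1) ^+ 2.
  by apply: sumr_ge0 => s _; rewrite sqr_ge0.
have -> : \sum_(s in J) (m%:R * d s - S1) ^+ 2 = m%:R * (m%:R * S2 - S1 ^+ 2).
  under eq_bigr do rewrite sqrrB exprMn.
  rewrite !big_split/= -mulr_sumr sumrN sumr_const -/m.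
  have -> : \sum_(i in J) m%:R * d i * S1 *+ 2 = m%:R * S1 ^+ 2 *+ 2.
    by rewrite sumrMnl -mulr_suml -mulr_sumr -/S1; congr (_ *+ _); ring.
  by rewrite -[S1 ^+ 2 *+ m]mulr_natl !mulr2n -/S2; ring.
by rewrite pmulr_rge0// subr_ge0.
Qed.

Lemma second_moment_lazy_weights tau v b d :
  \sum_(J : {set I}) lazy_weights tau v b J * (\sum_(s in J) d s) ^+ 2 =
  tau b * \sum_(J : {set I}) v J * (\sum_(s in J) d s) ^+ 2.
Proof. by rewrite sum_lazy_weights big_set0 expr0n mulr0 add0r. Qed.

(** Cauchy-Schwarz over the at most B species of a set bounds the second moment
    of the sum by B times the sum of the second moments tau q d ^ 2, and these
    exceed the variances tau q (1 - tau q) d ^ 2 by at most a factor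
    1 / (1 - c). *)
Lemma set_variance_le v tau (c : R) (B : nat) b d : weights (fun=> v) ->
  (forall J, v J != 0 -> (#|J| <= B)%N) ->
  0 <= tau b <= c -> c < 1 ->
  1 * set_variance (lazy_weights tau v b) d <=
  B%:R / (1 - c) * \sum_s marginal (lazy_weights tau v) s b *
    (1 - marginal (lazy_weights tau v) s b) * d s ^+ 2.
Proof.
move=> wv hB /andP[t0 tc] c1; rewrite mul1r /set_variance second_moment_lazy_weights.
apply: (@le_trans _ _ (tau b * (B%:R * \sum_s marginal (fun=> v) s b * d s ^+ 2))).
  rewrite lerBlDr; apply: ler_wpDr; first exact: sqr_ge0.
  rewrite ler_wpM2l// -(sum_marginal _ _ (fun s => d s ^+ 2)) mulr_sumr.
  apply: ler_sum => J _; rewrite [leRHS]mulrCA; have [->|vJ] := eqVneq (v J) 0.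
    by rewrite !mul0r.
  by rewrite ler_wpM2l ?(wv true).1// sqr_sum_le// hB.
rewrite -mulrA mulrCA ler_wpM2l// !mulr_sumr; apply: ler_sum => s _.
rewrite marginal_lazy_weights.
set m := marginal _ _ _.
have m0 : 0 <= m by exact: marginal_ge0.
have m1 : m <= 1 by exact: marginal_le1.
rewrite [leRHS](_ : _ = tau b * (m * d s ^+ 2) * ((1 - tau b * m) / (1 - c))).
  apply: ler_peMr; first by rewrite mulr_ge0// mulr_ge0// sqr_ge0.
  rewrite ler_pdivlMr ?subr_gt0// mul1r lerD2l lerN2.
  by rewrite (le_trans _ tc)// ler_piMr.
by ring.
Qed.

(** For sets with at most one element the square of the sum is the sum of the
    squares, and the square of the mean is of second order in tau. Together with
    set_variance_le this is used with c tending to 0. *)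
Lemma set_variance_ge v tau (c : R) b d : weights (fun=> v) ->
  (forall J, v J != 0 -> (#|J| <= 1)%N) ->
  0 <= tau b <= c -> c < 1 ->
  - 1 * set_variance (lazy_weights tau v b) d <=
  - (1 - c) * \sum_s marginal (lazy_weights tau v) s b *
    (1 - marginal (lazy_weights tau v) s b) * d s ^+ 2.
Proof.
move=> wv h1 /andP[t0 tc] c1; rewrite mulN1r mulNr lerN2.
pose q s := marginal (fun=> v) s b.
have q0 s : 0 <= q s by exact: marginal_ge0.
have q1 s : q s <= 1 by exact: marginal_le1.
have single (J : {set I}) : v J * (\sum_(s in J) d s) ^+ 2
    = v J * \sum_(s in J) d s ^+ 2.
  have [->|vJ] := eqVneq (v J) 0; first by rewrite !mul0r.
  have := h1 _ vJ; rewrite leq_eqVlt => /orP[/cards1P[s ->]|].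
    by rewrite !big_set1.
  by rewrite ltnS leqn0 cards_eq0 => /eqP ->; rewrite !big_set0 expr0n.
have qle : \sum_s q s <= 1.
  have := sum_marginal (fun=> v) b (fun=> 1 : R).
  under [RHS]eq_bigr do rewrite mulr1.
  rewrite /q => <-; rewrite -[leRHS](wv true).2; apply: ler_sum => J _.
  have [->|vJ] := eqVneq (v J) 0; first by rewrite mul0r.
  apply: ler_piMr; first exact: (wv true).1.
  by rewrite sumr_const lern1 (h1 _ vJ).
set D := \sum_s q s * d s ^+ 2.
have D0 : 0 <= D by apply: sumr_ge0 => s _; rewrite mulr_ge0// sqr_ge0.
have cs : (\sum_s q s * d s) ^+ 2 <= D.
  have [Q0|Q0] := eqVneq (\sum_s q s) 0.
    rewrite big1 ?expr0n// => s _; suff -> : q s = 0 by rewrite mul0r.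
    by move/eqP: Q0; rewrite psumr_eq0// => /allP/(_ s)/=; rewrite mem_index_enum => /(_ isT)/eqP.
  set Q := \sum_s q s in qle Q0; set S1 := \sum_s q s * d s.
  have Qp : 0 < Q by rewrite lt_neqAle eq_sym Q0 sumr_ge0.
  have : 0 <= \sum_s q s * (Q * d s - S1) ^+ 2.
    by apply: sumr_ge0 => s _; rewrite mulr_ge0// sqr_ge0.
  have -> : \sum_s q s * (Q * d s - S1) ^+ 2 = Q * (Q * D - S1 ^+ 2).
    have -> : \sum_s q s * (Q * d s - S1) ^+ 2 =
      \sum_s (Q ^+ 2 * (q s * d s ^+ 2) - 2 * Q * S1 * (q s * d s) + q s * S1 ^+ 2).
      by apply: eq_bigr => s _; ring.
    rewrite !big_split/= sumrN -!mulr_sumr -mulr_suml -/Q -/D -/S1; ring.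
  rewrite pmulr_rge0// subr_ge0 => /le_trans; apply.
  by rewrite ler_piMl.
have E2 : \sum_(J : {set I}) lazy_weights tau v b J * (\sum_(s in J) d s) ^+ 2 = tau b * D.
  rewrite second_moment_lazy_weights (eq_bigr _ (fun J _ => single J)).
  by rewrite (sum_marginal (fun=> v) b (fun s => d s ^+ 2)).
have E1 : \sum_(J : {set I}) lazy_weights tau v b J * (\sum_(s in J) d s) =
    tau b * \sum_s q s * d s.
  by rewrite sum_lazy_weights big_set0 mulr0 add0r (sum_marginal (fun=> v) b).
rewrite /set_variance E2 E1 exprMn.
apply: (@le_trans _ _ ((1 - c) * (tau b * D))).
  rewrite ler_wpM2l ?subr_ge0 ?(ltW c1)// /D mulr_sumr; apply: ler_sum => s _.
  rewrite marginal_lazy_weights -/(q s); rewrite -!mulrA ler_wpM2l// ler_wpM2l//.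
  by rewrite ler_piMl ?sqr_ge0// gerBl mulr_ge0.
have : tau b ^+ 2 * (\sum_s q s * d s) ^+ 2 <= tau b ^+ 2 * D.
  by rewrite ler_wpM2l// sqr_ge0.
have : tau b * tau b * D <= c * tau b * D by rewrite ler_wpM2r// ler_wpM2r.
rewrite expr2; lra.
Qed.

End one_step.

(** * The Poissonized average as a limit of slot averages *)

Section limits.
Context (R : realType) (I : finType).
Variables (v : {set I} -> R) (rate : bool -> R).
Hypothesis wv : weights (fun=> v).
Hypothesis rate_gt0 : forall b, 0 < rate b.
Implicit Types (Phi : (I -> nat * nat) -> R).

(** Each of the M slots of expedition b holds a draw with this probability,
    which makes rate b the mean number of draws. *)
Definition slot_prob (M : nat) b := rate b / M%:R.
Definition no_count : I -> nat * nat := fun=> (0, 0)%N.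
Definition slot_avg M Phi : R := avg (lazy_weights (slot_prob M) v) (slots M) Phi no_count.

Lemma slot_prob_bound : \forall M \near \oo, forall b, 0 <= slot_prob M b <= 1.
Proof.
near=> M => b; have M0 : (0 < M)%N by near: M; exists 1%N.
rewrite divr_ge0 ?(ltW (rate_gt0 b))//= ler_pdivrMr ?ltr0n// mul1r.
suff : rate true <= M%:R /\ rate false <= M%:R by case: b => -[].
by split; near: M; exact: nbhs_infty_ger.
Unshelve. all: by end_near. Qed.

(** Keeping only the outcomes with at most M draws in each expedition gives
    a finite sum that bounds the Poissonized mean of a nonnegative Phi from
    below. *)
Definition poisson_partial M Phi : R :=
  \sum_(j < M.+1) \sum_(k < M.+1) poisson_weight (rate true) j * poisson_weight (rate false) k *
    avg (fun=> v) (nseq j true ++ nseq k false) Phi no_count.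

(** A bound on the excess mass of the upper bounds of binomial_weight_le, in both
    expeditions together, over the truncated Poisson weights. *)
Definition poisson_gap M : R :=
  expR (rate true * (expR (rate true / M%:R) - 1)) *
  expR (rate false * (expR (rate false / M%:R) - 1)) -
  (\sum_(j < M.+1) poisson_weight (rate true) j) * (\sum_(k < M.+1) poisson_weight (rate false) k).

Lemma cvg_poisson_gap : poisson_gap @ \oo --> (0 : R).
Proof.
have h x : (fun M : nat => \sum_(j < M.+1) poisson_weight x j) @ \oo --> (1 : R).
  have := @cvg_sum_poisson_weight R x 1; rewrite subrr mulr0 expR0.
  under eq_fun do under eq_bigr do rewrite expr1n mulr1.
  by rewrite -cvg_shiftS.
rewrite -[X in _ --> X](subrr (1 * 1)); apply: cvgB; apply: cvgM => //;
  exact: cvg_expR_tilt.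
Qed.

Lemma slot_avg_le M Phi (C : R) : (0 < M)%N -> (forall b, 0 <= slot_prob M b <= 1) ->
  (forall x, 0 <= Phi x <= C) ->
  slot_avg M Phi <= poisson_partial M Phi + C * poisson_gap M.
Proof.
move=> M0 htau hPhi; rewrite /slot_avg avg_slots /poisson_partial /poisson_gap.
pose z b := expR (rate b / M%:R).
have z1 b : 1 <= z b by rewrite -expR0 ler_expR divr_ge0// ltW.
have z0 b : 0 <= z b by rewrite (le_trans _ (z1 b)).
have poi0 b j : 0 <= poisson_weight (rate b) j by rewrite poisson_weight_ge0// ltW.
have C0 : 0 <= C by have /andP[a1 a2] := hPhi no_count; exact: le_trans a1 a2.
pose T b := \sum_(j < M.+1) poisson_weight (rate b) j * z b ^+ j.
pose U b := \sum_(j < M.+1) poisson_weight (rate b) j.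
apply: (@le_trans _ _ (\sum_(j < M.+1) \sum_(k < M.+1)
  poisson_weight (rate true) j * poisson_weight (rate false) k *
    avg (fun=> v) (nseq j true ++ nseq k false) Phi no_count
  + C * (T true * T false - U true * U false))); last first.
  rewrite lerD2l ler_wpM2l// lerD2r.
  have T0 b : 0 <= T b by apply: sumr_ge0 => j _; rewrite mulr_ge0// exprn_ge0.
  by rewrite ler_pM//; apply: sum_poisson_weight_le => //; rewrite ltW.
rewrite /T /U !mulr_suml -sumrB mulr_sumr -big_split/=; apply: ler_sum => j _.
rewrite !mulr_sumr -sumrB mulr_sumr -big_split/=; apply: ler_sum => k _.
set a := avg _ _ _ _.
have a01 : 0 <= a <= C.
  pose l := nseq j true ++ nseq k false.
  rewrite -[X in X <= _](avg_cst l 0 no_count wv) -(avg_cst l C no_count wv).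
  by rewrite !avg_le// => x; case/andP: (hPhi x).
have ht b : 0 <= rate b <= M%:R.
  have /andP[t0 t1] := htau b; rewrite ltW//=.
  by move: t1; rewrite /slot_prob ler_pdivrMr ?ltr0n// mul1r.
have b1 := binomial_weight_le (ht true) M0 (ltn_ord j : (j <= M)%N).
have b2 := binomial_weight_le (ht false) M0 (ltn_ord k : (k <= M)%N).
have b3 := ler_pM (binomial_weight_ge0 M j (htau true)) (binomial_weight_ge0 M k (htau false)) b1 b2.
have /andP[a0 aC] := a01.
rewrite -/(slot_prob M true) -/(slot_prob M false) -/(z true) -/(z false) in b3.
have zz : 1 <= z true ^+ j * z false ^+ k by rewrite mulr_ege1// exprn_ege1.
have pp : 0 <= poisson_weight (rate true) j * poisson_weight (rate false) k by rewrite mulr_ge0.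
have := ler_wpM2r a0 b3.
have : 0 <= (poisson_weight (rate true) j * poisson_weight (rate false) k *
  (z true ^+ j * z false ^+ k - 1)) * (C - a).
  by apply: mulr_ge0; [apply: mulr_ge0 => //|]; rewrite subr_ge0.
lra.
Qed.

(** For the intended J, the Poissonized mean of Phi, the second hypothesis on
    partial sums is the first one for C - Phi; slot_avg_le for both functions
    squeezes the slot averages. *)
Lemma cvg_slot_avg Phi (C J : R) : (forall x, 0 <= Phi x <= C) ->
  (forall M, poisson_partial M Phi <= J) ->
  (forall M, poisson_partial M (fun x => C - Phi x) <= C - J) ->
  slot_avg M Phi @[M --> \oo] --> J.
Proof.
move=> hPhi hJ hJ'.
apply: (@squeeze_cvgr _ _ _ _
  (fun M : nat => J - C * poisson_gap M) (fun M : nat => J + C * poisson_gap M)).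
- near=> M.
  have M0 : (0 < M)%N by near: M; exists 1%N.
  have htau : forall b, 0 <= slot_prob M b <= 1 by near: M; exact: slot_prob_bound.
  have A1 := slot_avg_le M0 htau hPhi.
  have hPhi' : forall x, 0 <= C - Phi x <= C.
    by move=> x; have /andP[p0 pC] := hPhi x; rewrite subr_ge0 pC gerBl.
  have A2 := slot_avg_le M0 htau hPhi'.
  have e : slot_avg M (fun x => C - Phi x) = C - slot_avg M Phi.
    rewrite /slot_avg (@eq_avg _ _ _ _ _ (fun x => C + -1 * Phi x)); last first.
      by move=> x; rewrite mulN1r.
    by rewrite avgD avgZ avg_cst ?mulN1r//; exact: weights_lazy_weights.
  have := hJ M; have := hJ' M; rewrite e in A2; lra.
- rewrite -[X in _ --> X]subr0 -[in X in _ --> X](mulr0 C).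
  by apply: cvgB; [exact: cvg_cst|apply: cvgMl_tmp; exact: cvg_poisson_gap].
- rewrite -[X in _ --> X]addr0 -[in X in _ --> X](mulr0 C).
  by apply: cvgD; [exact: cvg_cst|apply: cvgMl_tmp; exact: cvg_poisson_gap].
Unshelve. all: by end_near. Qed.

End limits.

(** * The counts of one species *)

Section one_species.
Context (R : realType).
Implicit Types (p rate : bool -> R) (u H : nat -> R) (q : R).

(** For u = - H this is the contribution to the error of a species with counts
    y; for u = H ^ 2 it is the square of that contribution, because H vanishes
    at 0 (error_stat_sqr). *)
Definition error_stat u (y : nat * nat) : R :=
  ((y.1 == 0)%N && (0 < y.2)%N)%:R + u y.1.

Lemma species_avg_slots p u M : species_avg p (slots M) (error_stat u) (0, 0)%N =
  binomial_weight (p true) M 0 * (1 - binomial_weight (p false) M 0) +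
  \sum_(j < M.+1) binomial_weight (p true) M j * u j.
Proof.
rewrite species_avg_cat species_avg_nseq.
have phase2 j : species_avg p (nseq M false) (error_stat u) (j, 0)%N =
    (j == 0)%N%:R * (1 - binomial_weight (p false) M 0) + u j.
  rewrite species_avg_nseq /error_stat/=; under eq_bigr do rewrite mulrDr.
  rewrite big_split/= -mulr_suml sum_binomial_weight mul1r; congr (_ + _).
  rewrite big_ord_recl/= andbF mulr0 add0r.
  case: (j == 0)%N; last by rewrite mul0r big1// => i _; rewrite mulr0.
  have /eqP := sum_binomial_weight (p false) M; rewrite big_ord_recl/= addrC -subr_eq0.
  rewrite -opprB oppr_eq0 opprD addrA addrAC subr_eq0 mul1r => /eqP ->.
  by apply: eq_bigr => i _; rewrite mulr1.
under eq_bigr do rewrite /= addn0 phase2 mulrDr.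
rewrite big_split/=; congr (_ + _); rewrite big_ord_recl/= mul1r.
by rewrite big1 ?addr0// => i _; rewrite mul0r mulr0.
Qed.

Lemma species_avg_sqr_le p l f y : (forall b, 0 <= p b <= 1) ->
  species_avg p l f y ^+ 2 <= species_avg p l (fun y => f y ^+ 2) y.
Proof.
move=> p01; elim: l y => //= b l IH y; have /andP[p0 p1] := p01 b.
have := IH y; have := IH (add_count b 1 y).
set a1 := species_avg p l f (add_count b 1 y); set A1 := species_avg p l _ (add_count b 1 y).
set a0 := species_avg p l f y; set A0 := species_avg p l _ y => h1 h0.
have : 0 <= (1 - p b) * (A0 - a0 ^+ 2) by rewrite mulr_ge0// subr_ge0.
have : 0 <= p b * (A1 - a1 ^+ 2) by rewrite mulr_ge0// subr_ge0.
have : 0 <= p b * (1 - p b) * (a1 - a0) ^+ 2.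
  by rewrite mulr_ge0 ?sqr_ge0// mulr_ge0// subr_ge0.
lra.
Qed.

(** The mean of error_stat u for independent Poisson counts of parameters
    rate b * q, when u is supported below K. *)
Definition poisson_mean rate u K q : R :=
  expR (- (rate true * q)) * (1 - expR (- (rate false * q))) +
  \sum_(j < K) poisson_weight (rate true * q) j * u j.

Lemma cvg_species_avg_stat rate u K q : (forall b, 0 < rate b) -> 0 <= q ->
  (forall j, (K <= j)%N -> u j = 0) ->
  species_avg (fun b => slot_prob rate M b * q) (slots M) (error_stat u) (0, 0)%N
    @[M --> \oo] --> poisson_mean rate u K q.
Proof.
move=> rate0 q0 uK.
have c b j : (fun M => binomial_weight (slot_prob rate M b * q) M j) @ \oo -->
    poisson_weight (rate b * q) j.
  have -> : (fun M => binomial_weight (slot_prob rate M b * q) M j) =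
    (fun M => binomial_weight (rate b * q / M%:R) M j).
    by apply/funext => M; rewrite /slot_prob mulrAC.
  by apply: cvg_binomial_weight; rewrite mulr_ge0// ltW.
have p0 x : poisson_weight x 0 = expR (- x) :> R by rewrite /poisson_weight expr0 fact0 mulr1 divr1.
under eq_fun do rewrite species_avg_slots.
apply: cvgD.
  rewrite -!p0; apply: cvgM; first exact: c.
  by apply: cvgB; [exact: cvg_cst|exact: c].
have cK : (fun M => \sum_(j < K) binomial_weight (slot_prob rate M true * q) M j * u j) @ \oo
    --> \sum_(j < K) poisson_weight (rate true * q) j * u j.
  by apply: cvg_sumr => j; apply: cvgMr_tmp; exact: c.
apply: cvg_trans cK; apply: near_eq_cvg; near=> M.
have KM : (K <= M.+1)%N.
  by apply: leqW; near: M; exists K.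
rewrite (big_ord_widen M.+1 (fun j => binomial_weight (slot_prob rate M true * q) M j * u j))//.
rewrite big_mkcond; apply: eq_bigr => j _; case: ltnP => // Kj.
by rewrite uK// mulr0.
Unshelve. all: by end_near. Qed.

End one_species.

(** * Comparison of variances in the limit *)

Section all_species.
Context (R : realType) (I : finType).
Variables (v : {set I} -> R) (rate : bool -> R).
Hypothesis wv : weights (fun=> v).
Hypothesis rate_gt0 : forall b, 0 < rate b.
Variables (H : nat -> R) (K : nat).
Hypothesis H0 : H 0%N = 0.
Hypothesis HK : forall j, (K <= j)%N -> H j = 0.

Let q s := marginal (fun=> v) s true.
Let f := error_stat (fun j => - H j).
Definition error_mean x := poisson_mean rate (fun j => - H j) K x.
Definition error_second_moment x := poisson_mean rate (fun j => H j ^+ 2) K x.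

Lemma error_stat_sqr y : f y ^+ 2 = error_stat (fun j => H j ^+ 2) y.
Proof.
rewrite /f /error_stat; case: eqP => [->|_]/=; last by rewrite !add0r sqrrN.
by rewrite H0 oppr0 expr0n !addr0; case: ltnP => _; rewrite ?expr1n ?expr0n.
Qed.

Let q0 s : 0 <= q s. Proof. exact: marginal_ge0. Qed.

Let cvg_mean x : 0 <= x ->
  species_avg (fun b => slot_prob rate M b * x) (slots M) f (0, 0)%N @[M --> \oo]
    --> error_mean x.
Proof. by move=> x0; apply: cvg_species_avg_stat => // j Kj; rewrite HK// oppr0. Qed.

Let cvg_second x : 0 <= x ->
  species_avg (fun b => slot_prob rate M b * x) (slots M) (fun y => f y ^+ 2) (0, 0)%N
    @[M --> \oo] --> error_second_moment x.
Proof.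
move=> x0; under eq_fun do rewrite (eq_species_avg _ _ _ error_stat_sqr).
by apply: cvg_species_avg_stat => // j Kj; rewrite HK// expr0n.
Qed.

(** Jensen's inequality, inherited from the slot averages. *)
Lemma mean_sqr_le x : 0 <= x <= 1 -> error_mean x ^+ 2 <= error_second_moment x.
Proof.
move=> /andP[x0 x1].
have cm := cvg_mean x0; have cs := cvg_second x0.
have cmm : (fun M => species_avg (fun b => slot_prob rate M b * x) (slots M) f (0, 0)%N
  ^+ 2) @ \oo --> error_mean x ^+ 2 by rewrite expr2; apply: cvgM.
apply: ler_cvg_to cmm cs _ => /=.
near=> M.
have ht : forall b, 0 <= slot_prob rate M b <= 1 by near: M; exact: slot_prob_bound.
apply: species_avg_sqr_le => b; have /andP[t0 t1] := ht b.
by rewrite mulr_ge0//= mulr_ile1.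
Unshelve. all: by end_near. Qed.

Let S1 M := \sum_s species_avg (fun b => slot_prob rate M b * q s) (slots M) f (0, 0)%N.
Let S2 M := \sum_s (species_avg (fun b => slot_prob rate M b * q s) (slots M)
    (fun y => f y ^+ 2) (0, 0)%N
  - species_avg (fun b => slot_prob rate M b * q s) (slots M) f (0, 0)%N ^+ 2).

Let cvgS1 : S1 @ \oo --> \sum_s error_mean (q s).
Proof. by apply: cvg_sumr => s; exact: cvg_mean. Qed.

Let cvgS2 : S2 @ \oo --> \sum_s (error_second_moment (q s) - error_mean (q s) ^+ 2).
Proof.
apply: cvg_sumr => s; apply: cvgB; first exact: cvg_second.
by rewrite expr2; apply: cvgM; exact: cvg_mean.
Qed.

Let total (x : I -> nat * nat) : R := (\sum_s f (x s)) ^+ 2.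

Let tensorized M (k C : R) : (forall b, 0 <= slot_prob rate M b <= 1) ->
  (forall b d, k * set_variance (lazy_weights (slot_prob rate M) v b) d <=
     C * \sum_s marginal (lazy_weights (slot_prob rate M) v) s b *
       (1 - marginal (lazy_weights (slot_prob rate M) v) s b) * d s ^+ 2) ->
  k * (slot_avg v rate M total - S1 M ^+ 2) <= C * S2 M.
Proof.
move=> ht one.
have := variance_tensorization (weights_lazy_weights ht wv) one (slots M) (fun=> f)
  (@no_count I).
rewrite /slot_avg /S1 /S2.
have e s : marginal (lazy_weights (slot_prob rate M) v) s = (fun b => slot_prob rate M b * q s).
  by apply/funext => b; rewrite marginal_lazy_weights.
by under [X in _ - X ^+ 2]eq_bigr do rewrite e;
  under [X in _ <= _ * X]eq_bigr do rewrite e.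
Qed.

Let c (M : nat) : R := (rate true + rate false) / M%:R.

Let cvgc : c @ \oo --> (0 : R).
Proof.
rewrite -[X in _ --> X](mulr0 (rate true + rate false)); apply: cvgMl_tmp.
apply/(@gtr0_cvgV0 R _ \oo _ (fun M : nat => M%:R)); last exact: cvgr_idn.
by near=> M; rewrite ltr0n; near: M; exists 1%N.
Unshelve. all: by end_near. Qed.

Let near_c : \forall M \near \oo, c M < 1.
Proof. exact: (cvgr_lt _ cvgc). Qed.

Let tau_c M b : 0 <= slot_prob rate M b <= c M.
Proof.
rewrite divr_ge0 ?(ltW (rate_gt0 b))//= ler_wpM2r// ?invr_ge0//.
by case: b; rewrite ?lerDl ?lerDr ltW.
Qed.

(** The constants B / (1 - c) from the slots tend to B, since c is of order
    1 / M. *)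
Lemma limit_le (B : nat) (J : R) : (forall J, v J != 0 -> (#|J| <= B)%N) ->
  slot_avg v rate M total @[M --> \oo] --> J ->
  J <= (\sum_s error_mean (q s)) ^+ 2 +
       B%:R * \sum_s (error_second_moment (q s) - error_mean (q s) ^+ 2).
Proof.
move=> hB cJ.
have cR : (fun M => S1 M ^+ 2 + B%:R / (1 - c M) * S2 M) @ \oo -->
  (\sum_s error_mean (q s)) ^+ 2 +
       B%:R / (1 - 0) * \sum_s (error_second_moment (q s) - error_mean (q s) ^+ 2).
  apply: cvgD; first by rewrite expr2; apply: cvgM.
  apply: cvgM; last exact: cvgS2.
  apply: cvgM; first exact: cvg_cst.
  apply: cvgV; first by rewrite subr0 oner_eq0.
  by apply: cvgB; [exact: cvg_cst|exact: cvgc].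
rewrite subr0 divr1 in cR; apply: ler_cvg_to cJ cR _.
near=> M.
have ht : forall b, 0 <= slot_prob rate M b <= 1 by near: M; exact: slot_prob_bound.
have c1 : c M < 1 by near: M; exact: near_c.
have := @tensorized M 1 (B%:R / (1 - c M)) ht
  (fun b d => set_variance_le d wv hB (tau_c M b) c1).
by rewrite mul1r lerBlDl.
Unshelve. all: by end_near. Qed.

Lemma limit_ge (J : R) : (forall J, v J != 0 -> (#|J| <= 1)%N) ->
  slot_avg v rate M total @[M --> \oo] --> J ->
  (\sum_s error_mean (q s)) ^+ 2 +
       \sum_s (error_second_moment (q s) - error_mean (q s) ^+ 2) <= J.
Proof.
move=> hB cJ.
have cR : (fun M => S1 M ^+ 2 + (1 - c M) * S2 M) @ \oo -->
  (\sum_s error_mean (q s)) ^+ 2 +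
       (1 - 0) * \sum_s (error_second_moment (q s) - error_mean (q s) ^+ 2).
  apply: cvgD; first by rewrite expr2; apply: cvgM.
  apply: cvgM; last exact: cvgS2.
  by apply: cvgB; [exact: cvg_cst|exact: cvgc].
rewrite subr0 mul1r in cR; apply: ler_cvg_to cR cJ _.
near=> M.
have ht : forall b, 0 <= slot_prob rate M b <= 1 by near: M; exact: slot_prob_bound.
have c1 : c M < 1 by near: M; exact: near_c.
have := @tensorized M (- 1) (- (1 - c M)) ht
  (fun b d => set_variance_ge d wv hB (tau_c M b) c1).
by rewrite mulN1r mulNr lerN2 lerBrDl.
Unshelve. all: by end_near. Qed.

End all_species.

(** * Exponential generating functions on [0, t] *)

Section series_tails.
Context (R : realType).
Implicit Types (u H : nat -> R) (t p : R).

(** These weights majorize the terms of the generating function at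
    p t for all p in [0, 1] at once. *)
Definition abs_coeff u t (i : nat) : R := `|u i| * t ^+ i / i`!%:R.
Definition summable_at u t := cvgn (series (abs_coeff u t)).
Definition series_tail u t K : R := limn (series (abs_coeff u t)) - series (abs_coeff u t) K.

Lemma abs_coeff_ge0 u t i : 0 <= t -> 0 <= abs_coeff u t i.
Proof. by move=> t0; rewrite /abs_coeff mulr_ge0 ?mulr_ge0 ?exprn_ge0. Qed.

Lemma series_abs_le u t n : 0 <= t -> summable_at u t ->
  series (abs_coeff u t) n <= limn (series (abs_coeff u t)).
Proof.
move=> t0 su; apply: nondecreasing_cvgn_le => //.
apply/nondecreasing_seqP => m; rewrite seriesSr lerDl; exact: abs_coeff_ge0.
Qed.

Lemma series_tail_ge0 u t K : 0 <= t -> summable_at u t -> 0 <= series_tail u t K.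
Proof. by move=> t0 su; rewrite subr_ge0 series_abs_le. Qed.

Lemma cvg_series_tail u t : summable_at u t -> series_tail u t @ \oo --> (0 : R).
Proof.
move=> su; rewrite -[X in _ --> X](subrr (limn (series (abs_coeff u t)))).
by apply: cvgB; [exact: cvg_cst|exact: su].
Qed.

Lemma egf_term_le u t p e i : 0 <= t -> 0 <= p <= 1 -> (e <= i)%N ->
  `|u i / i`!%:R * (p * t) ^+ i| <= p ^+ e * abs_coeff u t i.
Proof.
move=> t0 /andP[p0 p1] ei; rewrite /abs_coeff !normrM normfV normrX.
rewrite (ger0_norm (ler0n _ _)) (ger0_norm (mulr_ge0 p0 t0)) exprMn.
rewrite [leLHS](_ : _ = p ^+ i * (`|u i| * t ^+ i / i`!%:R)); last by ring.
by rewrite ler_wpM2r ?abs_coeff_ge0// ler_wiXn2l.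
Qed.

Lemma cvg_egf u t p : 0 <= t -> summable_at u t -> u 0%N = 0 -> 0 <= p <= 1 ->
  series (fun i => u i / i`!%:R * (p * t) ^+ i) @ \oo --> egf u (p * t).
Proof.
move=> t0 su u0 p01.
have -> : egf u (p * t) = limn (series (fun i => u i / i`!%:R * (p * t) ^+ i)).
  rewrite /egf; congr (lim (_ @ \oo)); apply/funext => -[|n].
    by rewrite /series/= !big_geq.
  by rewrite /series/= [RHS]big_nat_recl// big_add1 u0 !mul0r add0r.
apply: normed_cvg; apply: (series_le_cvg _ _ _ su) => i /=.
- exact: normr_ge0.
- exact: abs_coeff_ge0.
- by have := egf_term_le u t0 p01 (leq0n i); rewrite mul1r.
Qed.

Lemma summable_atN u t : summable_at u t -> summable_at (fun i => - u i) t.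
Proof.
rewrite /summable_at (_ : abs_coeff (fun i => - u i) t = abs_coeff u t)//.
by apply/funext => i; rewrite /abs_coeff normrN.
Qed.

Lemma egfN u t p : 0 <= t -> summable_at u t -> u 0%N = 0 -> 0 <= p <= 1 ->
  egf (fun i => - u i) (p * t) = - egf u (p * t).
Proof.
move=> t0 su u0 p01.
have c := cvg_egf t0 (summable_atN su) (etrans (congr1 _ u0) (oppr0 _)) p01.
apply: (cvg_unique _ c) => //.
have -> : series (fun i => - u i / i`!%:R * (p * t) ^+ i) =
    - series (fun i => u i / i`!%:R * (p * t) ^+ i).
  apply/funext => n; change (series (fun i => - u i / i`!%:R * (p * t) ^+ i) n =
    - series (fun i => u i / i`!%:R * (p * t) ^+ i) n).
  by rewrite /series/= -sumrN; apply: eq_bigr => i _; ring.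
by apply: cvgN; exact: cvg_egf.
Qed.

(** Each term of index i >= e carries p ^ i <= p ^ e. The case e = 1 makes the
    truncation error proportional to p, which is summable over species; the case
    e = 2 gives the first-order expansion at 0. *)
Lemma egf_tail u t p K e : 0 <= t -> summable_at u t -> u 0%N = 0 ->
  0 <= p <= 1 -> (e <= K)%N ->
  `|egf u (p * t) - \sum_(j < K) u j * (p * t) ^+ j / j`!%:R| <=
    p ^+ e * series_tail u t K.
Proof.
move=> t0 su u0 p01 eK; have /andP[p0 p1] := p01.
have ca := cvg_egf t0 su u0 p01.
set a := fun i => _ in ca.
have dif n : (K <= n)%N -> `|series a n - series a K| <= p ^+ e * series_tail u t K.
  move=> Kn; rewrite sub_series_geq// (le_trans (ler_norm_sum _ _ _))//.
  apply: (@le_trans _ _ (p ^+ e * (series (abs_coeff u t) n - series (abs_coeff u t) K))).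
    rewrite sub_series_geq// mulr_sumr big_nat_cond [leRHS]big_nat_cond.
    apply: ler_sum => i /andP[/andP[Ki _] _].
    by apply: egf_term_le => //; exact: leq_trans eK Ki.
  by rewrite ler_wpM2l ?exprn_ge0// lerD2r series_abs_le.
have -> : \sum_(j < K) u j * (p * t) ^+ j / j`!%:R = series a K.
  by rewrite /series/= big_mkord; apply: eq_bigr => j _; rewrite /a; ring.
have cd : (fun n => `|series a n - series a K|) @ \oo -->
    `|egf u (p * t) - series a K|.
  by apply: cvg_norm; apply: cvgB; [exact: ca|exact: cvg_cst].
apply: (cvgr_to_le cd); near=> n; apply: dif; near: n; exact: nbhs_infty_ge.
Unshelve. all: by end_near. Qed.

(** At u = - H and u = H ^ 2 these are the first two moments of the error
    contribution of a species of probability p. *)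
Definition profile r t u p : R :=
  expR (- (p * t)) * (1 - expR (- (r * p * t)) + egf u (p * t)).

Lemma poisson_mean_tail r t u p K : 0 <= t -> summable_at u t -> u 0%N = 0 ->
  0 <= p <= 1 -> (0 < K)%N ->
  `|poisson_mean (fun b => if b then t else r * t)
     (fun j => if (j < K)%N then u j else 0) K p - profile r t u p| <=
  p * series_tail u t K.
Proof.
move=> t0 su u0 p01 K0; have /andP[p0 _] := p01.
have := egf_tail t0 su u0 p01 K0; rewrite expr1 => h; apply: le_trans h.
rewrite /poisson_mean /profile.
have -> : \sum_(j < K) poisson_weight (t * p) j * (if (j < K)%N then u j else 0) =
    expR (- (p * t)) * \sum_(j < K) u j * (p * t) ^+ j / j`!%:R.
  rewrite mulr_sumr; apply: eq_bigr => j _; rewrite ltn_ord /poisson_weight (mulrC t p).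
  by ring.
rewrite (mulrC t p) (mulrAC r t p) -mulrDr -mulrBr opprD addrACA subrr add0r.
rewrite normrM (ger0_norm (expR_ge0 _)) distrC ler_piMl//.
by rewrite -expR0 ler_expR oppr_le0 mulr_ge0.
Qed.

Lemma expRN_bound (y : R) : 0 <= y -> 1 - y <= expR (- y) <= 1 - y + y ^+ 2.
Proof.
move=> y0; apply/andP; split; first exact: expR_ge1Dx.
have y1 : 0 < 1 + y by rewrite ltr_pwDl.
rewrite expRN (@le_trans _ _ (1 + y)^-1)//.
  by rewrite lef_pV2 ?posrE ?expR_gt0// expR_ge1Dx.
rewrite -[leLHS]mul1r ler_pdivrMr//.
rewrite (_ : _ * _ = 1 + y ^+ 3); first by rewrite lerDl exprn_ge0.
by ring.
Qed.

Lemma profile_local r t u : 0 <= r -> 0 <= t -> summable_at u t -> u 0%N = 0 ->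
  exists C, forall p, 0 <= p <= 1 ->
    `|profile r t u p - p * (t * (r + u 1%N))| <= C * p ^+ 2.
Proof.
move=> r0 t0 su u0.
set x := t * (r + u 1%N); pose E := (r * t) ^+ 2 + series_tail u t 2.
have E0 : 0 <= E by rewrite addr_ge0 ?sqr_ge0 ?series_tail_ge0.
exists (t * (`|x| + E) + E) => p p01; have /andP[p0 p1] := p01.
pose a := 1 - expR (- (r * p * t)) + egf u (p * t).
have ha : `|a - p * x| <= E * p ^+ 2.
  have h1 := egf_tail t0 su u0 p01 (leqnn 2).
  rewrite !big_ord_recl big_ord0/= u0 !mul0r add0r addr0 expr1 divr1 in h1.
  have h2 : `|1 - expR (- (r * p * t)) - r * p * t| <= (r * t) ^+ 2 * p ^+ 2.
    have /expRN_bound/andP[l1 l2] : 0 <= r * p * t by rewrite !mulr_ge0.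
    rewrite (_ : (r * t) ^+ 2 * p ^+ 2 = (r * p * t) ^+ 2); last by ring.
    rewrite ler_norml; move: (sqr_ge0 (r * p * t)); lra.
  rewrite (_ : a - p * x = (1 - expR (- (r * p * t)) - r * p * t) +
    (egf u (p * t) - u 1%N * (p * t))); last by rewrite /a /x; ring.
  rewrite (le_trans (ler_normD _ _))// /E mulrDl.
  apply: lerD; first exact: h2.
  by rewrite [leRHS]mulrC; exact: h1.
have ha' : `|a| <= (`|x| + E) * p.
  rewrite -[a](subrK (p * x)) (le_trans (ler_normD _ _))// mulrDl addrC lerD//.
    by rewrite normrM (ger0_norm p0) mulrC.
  by rewrite (le_trans ha)// ler_wpM2l// expr2 ler_piMl.
rewrite (_ : profile r t u p - p * x = (expR (- (p * t)) - 1) * a + (a - p * x));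
  last by rewrite /profile -/a; ring.
rewrite (le_trans (ler_normD _ _))// [leRHS]mulrDl; apply: lerD; last exact: ha.
rewrite normrM.
have h3 : `|expR (- (p * t)) - 1| <= p * t.
  have pt0 : 0 <= p * t by rewrite mulr_ge0.
  have /andP[l1 _] := expRN_bound pt0.
  have l2 : expR (- (p * t)) <= 1 by rewrite -[leRHS]expR0 ler_expR oppr_le0.
  by rewrite ler_norml; lra.
rewrite (le_trans (ler_pM _ _ h3 ha'))//.
by rewrite le_eqVlt; apply/orP; left; apply/eqP; ring.
Qed.

End series_tails.

(** The preimage of any set under g \o h is a countable union of fibers of h. *)
Lemma measurable_countable_fibers d d' (T : measurableType d) (T' : measurableType d')
    (C : countType) (h : T -> C) (g : C -> T') D :
  (forall c, measurable (h @^-1` [set c])) -> measurable_fun D (g \o h).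
Proof.
move=> mh mD Y mY; apply: measurableI => //.
have -> : (g \o h) @^-1` Y =
    \bigcup_c (if g c \in Y then h @^-1` [set c] else set0).
  apply/seteqP; split => [x /= Yx|x [c _]].
    by exists (h x) => //; rewrite mem_set.
  by case: ifPn => //; rewrite inE => Yc /= ->.
apply: countable_bigcupT_measurable => // c; case: ifP => _ //.
Qed.

(** * The joint law of the counts in an experiment *)

Section transfer.
Context (R : realType) (S : countType) (mu : probability {fset S} R) (t t' : R).
Hypotheses (t0 : 0 < t) (t0' : 0 < t').
Context d (Omega : measurableType d) (P : probability Omega R).
Variable e : experiment mu t t' P.
Context (I : finType) (tr : {fset S} -> {set I}).

(** The set of species is reduced to a finite index set I through an arbitrary
    map tr; the draws then matter only through the law of tr. *)
Definition trace_law (J : {set I}) : R := fine (mu (tr @^-1` [set J])).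

Lemma trace_lawE J : mu (tr @^-1` [set J]) = (trace_law J)%:E.
Proof. by rewrite /trace_law fineK// fin_num_measure. Qed.

Lemma weights_trace : weights (fun=> trace_law).
Proof.
move=> _; split=> [J|]; first by rewrite -lee_fin -trace_lawE.
apply: EFin_inj; rewrite -sumEFin -(probability_setT mu).
under eq_bigr do rewrite -trace_lawE.
rewrite fsbig_seq ?index_enum_uniq// -measure_fin_bigcup//.
- congr (mu _); apply/seteqP; split => // A _.
  by exists (tr A) => //=; rewrite mem_index_enum.
- by move=> J J' _ _ [A [/= -> ->]].
Qed.

Definition draw_trace n (w : Omega) := tr (draw e n w).

Definition counts (w : Omega) : I -> nat * nat := fun i =>
  (\sum_(0 <= n < size1 e w) (i \in draw_trace n w),
   \sum_(size1 e w <= n < size1 e w + size2 e w) (i \in draw_trace n w))%N.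

(** The counts as a function of a finite list of reduced draws, so that they
    can be built up one draw at a time (recorded_rcons). *)
Definition recorded j (ps : seq {set I}) : I -> nat * nat := fun i =>
  (\sum_(0 <= n < minn (size ps) j) (i \in nth finset.set0 ps n),
   \sum_(j <= n < size ps) (i \in nth finset.set0 ps n))%N.

Lemma recorded_rcons j ps J :
  recorded j (rcons ps J) = add_draw (size ps < j)%N J (recorded j ps).
Proof.
apply/funext => i; rewrite /recorded /add_draw /add_count size_rcons.
have r n : (n < size ps)%N -> nth finset.set0 (rcons ps J) n = nth finset.set0 ps n.
  by move=> h; rewrite nth_rcons h.
have rl : nth finset.set0 (rcons ps J) (size ps) = J.
  by rewrite nth_rcons ltnn eqxx.
case: ltnP => jq; [rewrite (minn_idPl jq)
                  |rewrite (minn_idPr (leqW jq))];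
  rewrite /=; congr (_, _).
- rewrite big_nat_recr//= rl addnC.
  by congr (_ + _)%N; apply: eq_big_nat => n /andP[_ nq]; rewrite r.
- by rewrite !big_geq// ltnW.
- by apply: eq_big_nat => n /andP[_ nq]; rewrite r// (leq_trans nq).
- rewrite big_nat_recr//= rl addnC; congr (_ + _)%N.
  by apply: eq_big_nat => n /andP[_ nq]; rewrite r.
Qed.

Definition history j k (ps : seq {set I}) : set Omega :=
  [set w | [/\ size1 e w = j, size2 e w = k &
    forall n, (n < size ps)%N -> draw_trace n w = nth finset.set0 ps n]].

Let hist_event (j k : nat) (ps : seq {set I}) (i : nat + bool) : set Omega :=
  match i with
  | inl n => draw e n @^-1` (tr @^-1` [set nth finset.set0 ps n])
  | inr true => size1 e @^-1` [set j]
  | inr false => size2 e @^-1` [set k]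
  end.

Let hist_index (q : nat) : seq (nat + bool) :=
  inr true :: inr false :: map inl (iota 0 q).

Let hist_index_uniq q : uniq (hist_index q).
Proof.
rewrite /hist_index /= map_inj_uniq ?iota_uniq ?andbT; last by move=> ? ? [].
by rewrite inE/=; apply/andP; split; apply/mapP => -[].
Qed.

Let historyE j k ps : history j k ps =
  \bigcap_(i in [set` [fset i in hist_index (size ps)]%fset]) hist_event j k ps i.
Proof.
apply/seteqP; split => [w [h1 h2 h3] [n|[]]|w h].
- by rewrite /= inE /hist_index !inE/= mem_map ?mem_iota//= => [|? ? []//] /h3.
- by [].
- by [].
- split.
  + by apply: (h (inr true)); rewrite /= !inE.
  + by apply: (h (inr false)); rewrite /= !inE.
  + move=> n nq; apply: (h (inl n)).
    by rewrite /= inE /hist_index !inE/= mem_map ?mem_iota//= => ? ? [].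
Qed.

Lemma measurable_history j k ps : measurable (history j k ps).
Proof.
rewrite historyE; apply: fin_bigcap_measurable => //.
move=> [n|[]] _; rewrite /hist_event -[X in measurable X]setTI;
  exact: measurable_funPT.
Qed.

Lemma probability_history j k ps : P (history j k ps) =
  (poisson_weight t j * poisson_weight t' k * \prod_(J <- ps) trace_law J)%:E.
Proof.
rewrite historyE (@experiment_indep _ _ _ _ _ _ _ _ e); last first.
  by move=> [n|[]] _; eexists; last reflexivity.
have -> : (\prod_(i <- [fset i in hist_index (size ps)]%fset) P (hist_event j k ps i))%E =
    (\prod_(i <- hist_index (size ps)) P (hist_event j k ps i))%E.
  apply: perm_big; apply: uniq_perm; rewrite ?fset_uniq//.
  by move=> i; apply/imfsetP/idP => [[x xi ->]|ii] //; exists i.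
rewrite /hist_index !big_cons/= (size1_law e) (size2_law e) !poisson_pmfE//.
rewrite muleA -EFinM [RHS]EFinM; congr (_ * _)%E.
rewrite big_map [in RHS](big_nth finset.set0) /index_iota subn0.
rewrite -prodEFin; apply: eq_bigr => n _; rewrite draw_law; exact: trace_lawE.
Qed.

Lemma counts_history j k ps w : size ps = (j + k)%N -> history j k ps w ->
  counts w = recorded j ps.
Proof.
move=> sz [h1 h2 h3]; apply/funext => i; rewrite /counts /recorded h1 h2 sz.
rewrite (minn_idPr (leq_addr _ _)); congr (_, _); apply: eq_big_nat => n /andP[_ nq].
  by rewrite h3// sz (leq_trans nq)// leq_addr.
by rewrite h3// sz.
Qed.

Lemma history_rcons j k ps :
  history j k ps = \big[setU/set0]_J history j k (rcons ps J).
Proof.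
rewrite -bigcup_seq; apply/seteqP; split => w.
  move=> [h1 h2 h3]; exists (draw_trace (size ps) w); first by rewrite /= mem_index_enum.
  split=> // n; rewrite size_rcons ltnS leq_eqVlt nth_rcons.
  move=> /orP[/eqP ->|nq]; first by rewrite ltnn eqxx.
  by rewrite nq h3.
move=> [J _ [h1 h2 h3]]; split=> // n nq.
by rewrite h3 ?size_rcons ?ltnS 1?ltnW// nth_rcons nq.
Qed.

Lemma trivIset_history j k ps :
  trivIset [set` index_enum {set I}] (fun J => history j k (rcons ps J)).
Proof.
move=> J J' _ _ [w [[_ _ h] [_ _ h']]].
have sz J1 : (size ps < size (rcons ps J1))%N by rewrite size_rcons.
by have := h _ (sz J); rewrite (h' _ (sz J')) !nth_rcons ltnn eqxx.
Qed.

(** The counts depend on the outcome through countably many values only. *)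
Definition transcript (w : Omega) : nat * nat * seq {set I} :=
  (size1 e w, size2 e w, [seq draw_trace n w | n <- iota 0 (size1 e w + size2 e w)]).

Lemma measurable_transcript c : measurable (transcript @^-1` [set c]).
Proof.
case: c => -[j k] ps; have [sz|sz] := eqVneq (size ps) (j + k)%N.
  suff -> : transcript @^-1` [set (j, k, ps)] = history j k ps by exact: measurable_history.
  apply/seteqP; split => w /=.
    move=> [h1 h2 <-]; split=> // n; rewrite size_map size_iota => nq.
    by rewrite (nth_map 0%N) ?size_iota// nth_iota.
  move=> [h1 h2 h3]; rewrite /transcript h1 h2; congr (_, _).
  apply: (@eq_from_nth _ finset.set0); rewrite size_map size_iota// => n nq.
  by rewrite (nth_map 0%N) ?size_iota// nth_iota// add0n h3// sz.
suff -> : transcript @^-1` [set (j, k, ps)] = set0 by [].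
rewrite -subset0 => w /= [h1 h2 h3]; move/eqP: sz; apply.
by rewrite -h3 size_map size_iota h1 h2.
Qed.

Lemma counts_transcript w : counts w = recorded (transcript w).1.1 (transcript w).2.
Proof.
apply: (@counts_history _ (size2 e w)); first by rewrite /= size_map size_iota.
split=> // n; rewrite /= size_map size_iota => nq.
by rewrite (nth_map 0%N) ?size_iota// nth_iota.
Qed.

Lemma measurable_counts (F : (I -> nat * nat) -> \bar R) D :
  measurable_fun D (fun w => F (counts w)).
Proof.
have -> : (fun w => F (counts w)) = (fun c => F (recorded c.1.1 c.2)) \o transcript.
  by apply/funext => w; rewrite /= counts_transcript.
apply: measurable_countable_fibers; exact: measurable_transcript.
Qed.

Local Notation rate := (fun b : bool => if b then t else t').

(** Backward induction on the number of draws that ps leaves unspecified: a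
    history is the disjoint union of its one-draw extensions, whose probabilities
    factor by independence. *)
Lemma integral_history (Phi : (I -> nat * nat) -> R) j k ps :
  (forall x, 0 <= Phi x) -> (size ps <= j + k)%N ->
  (\int[P]_(w in history j k ps) (Phi (counts w))%:E)%E =
  (poisson_weight t j * poisson_weight t' k * \prod_(J <- ps) trace_law J *
   avg (fun=> trace_law) (drop (size ps) (nseq j true ++ nseq k false)) Phi
     (recorded j ps))%:E.
Proof.
move=> Phi0; move hm : (j + k - size ps)%N => m.
elim: m ps hm => [|m IH] ps hm szle.
  have sz : size ps = (j + k)%N.
    by apply/eqP; rewrite eqn_leq szle -subn_eq0 hm.
  rewrite drop_oversize; last by rewrite size_cat !size_nseq sz.
  rewrite (@eq_integral _ _ _ _ _ (cst (Phi (recorded j ps))%:E)); last first.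
    by move=> w; rewrite inE => /(counts_history sz) ->.
  rewrite integral_cst; last exact: measurable_history.
  by rewrite [X in (_ * X)%E](probability_history j k ps) -EFinM mulrC.
have szlt : (size ps < j + k)%N by rewrite -subn_gt0 hm.
rewrite {1}history_rcons ge0_integral_bigsetU//; first last.
- by move=> w _; rewrite lee_fin.
- exact: (measurable_counts (fun x => (Phi x)%:E)).
- exact: trivIset_history.
- exact: index_enum_uniq.
- by move=> J; exact: measurable_history.
have -> : drop (size ps) (nseq j true ++ nseq k false) =
    (size ps < j)%N :: drop (size ps).+1 (nseq j true ++ nseq k false).
  rewrite (drop_nth false) ?size_cat ?size_nseq//; congr cons.
  rewrite nth_cat size_nseq; case: ltnP => h; rewrite nth_nseq ?h//.
  by case: ifP.
rewrite /= mulr_sumr -sumEFin; apply: eq_bigr => J _.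
rewrite IH ?size_rcons//; last by rewrite subnS hm.
by rewrite -cats1 big_cat big_seq1 cats1 recorded_rcons/=; congr EFin; ring.
Qed.

Lemma poisson_partial_le (Phi : (I -> nat * nat) -> R) M :
  (forall x, 0 <= Phi x) ->
  ((poisson_partial trace_law rate M Phi)%:E <= \int[P]_w (Phi (counts w))%:E)%E.
Proof.
move=> Phi0; pose D (c : 'I_M.+1 * 'I_M.+1) := history c.1 c.2 [::].
have mD c : measurable (D c) by exact: measurable_history.
have mP A : measurable_fun A (fun w => (Phi (counts w))%:E).
  exact: (measurable_counts (fun x => (Phi x)%:E)).
apply: (@le_trans _ _ (\int[P]_(w in \big[setU/set0]_c D c) (Phi (counts w))%:E)%E).
  rewrite ge0_integral_bigsetU//; first last.
  - by move=> w _; rewrite lee_fin.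
  - move=> [j k] [j' k'] _ _ [w [[/= h1 h2 _] [/= h1' h2' _]]].
    by congr (_, _); apply: val_inj; rewrite /= -?h1 -?h2.
  - exact: index_enum_uniq.
  rewrite /poisson_partial pair_bigA/= -sumEFin le_eqVlt; apply/orP; left; apply/eqP.
  apply: eq_bigr => -[j k] _ /=; rewrite integral_history// big_nil mulr1 drop0.
  congr (_ * avg _ _ _ _)%:E; apply/funext => i; rewrite /recorded/=.
  by rewrite min0n !big_geq.
apply: ge0_subset_integral => //.
  exact: bigsetU_measurable.
by move=> w _; rewrite lee_fin.
Qed.

(** The partial sums of poisson_partial are means over disjoint events, hence
    lie below the integral, for Phi as well as for C - Phi. *)
Lemma integral_counts (Phi : (I -> nat * nat) -> R) (C : R) :
  (forall x, 0 <= Phi x <= C) ->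
  exists2 J, (\int[P]_w (Phi (counts w))%:E = J%:E)%E &
    slot_avg trace_law rate M Phi @[M --> \oo] --> J.
Proof.
move=> hPhi.
have Phi0 x : 0 <= Phi x by case/andP: (hPhi x).
have mP D := measurable_counts (D := D) (fun x => (Phi x)%:E).
have ile : (\int[P]_w (Phi (counts w))%:E <= C%:E)%E.
  rewrite -[leRHS]mule1 -(probability_setT P) -integral_cst//.
  apply: ge0_le_integral => //.
  - by move=> w _; rewrite lee_fin.
  - by move=> w _; rewrite lee_fin; case/andP: (hPhi (counts w)).
have ifin : (\int[P]_w (Phi (counts w))%:E)%E \is a fin_num.
  rewrite ge0_fin_numE; first exact: le_lt_trans ile (ltry _).
  by apply: integral_ge0 => w _; rewrite lee_fin.
exists (fine (\int[P]_w (Phi (counts w))%:E)); first by rewrite fineK.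
have isum : (\int[P]_w (Phi (counts w))%:E + \int[P]_w (C - Phi (counts w))%:E = C%:E)%E.
  rewrite -ge0_integralD//.
  - rewrite -[RHS]mule1 -(probability_setT P) -integral_cst//.
    by apply: eq_integral => w _; rewrite -EFinD addrC subrK.
  - by move=> w _; rewrite lee_fin.
  - by move=> w _; rewrite lee_fin subr_ge0; case/andP: (hPhi (counts w)).
  - exact: (measurable_counts (fun x => (C - Phi x)%:E)).
apply: (cvg_slot_avg weights_trace _ hPhi) => [[]//|M|M].
  by rewrite -lee_fin fineK// poisson_partial_le.
rewrite -lee_fin EFinB fineK//.
have := @poisson_partial_le (fun x => C - Phi x) M.
have -> : (C%:E - \int[P]_w (Phi (counts w))%:E)%E =
    (\int[P]_w (C - Phi (counts w))%:E)%E by rewrite -isum addeC addeK.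
by apply => x; rewrite subr_ge0; case/andP: (hPhi x).
Qed.

End transfer.

(** * Second moments of sums of error contributions *)

Section second_moment.
Context (R : realType) (S : countType) (mu : probability {fset S} R) (t t' : R).
Hypotheses (t0 : 0 < t) (t0' : 0 < t').
Context d (Omega : measurableType d) (P : probability Omega R).
Variable e : experiment mu t t' P.
Context (I : finType) (tr : {fset S} -> {set I}).
Variables (H : nat -> R) (K : nat).
Hypothesis H0 : H 0%N = 0.
Hypothesis HK : forall j, (K <= j)%N -> H j = 0.

Local Notation rate := (fun b : bool => if b then t else t').
Let q s := marginal (fun=> trace_law mu tr) s true.

(** The two bounds compare the variance of the sum with the variances of its
    terms, exactly, since the factors depending on M have tended to 1. *)
Lemma second_moment_counts : exists J,
  [/\ (\int[P]_w ((\sum_s error_stat (fun j => - H j) (counts e tr w s)) ^+ 2)%:E = J%:E)%E,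
   forall B, (forall J, trace_law mu tr J != 0 -> (#|J| <= B)%N) ->
     J <= (\sum_s error_mean rate H K (q s)) ^+ 2 +
       B%:R * \sum_s (error_second_moment rate H K (q s) - error_mean rate H K (q s) ^+ 2)
   & (forall J, trace_law mu tr J != 0 -> (#|J| <= 1)%N) ->
     (\sum_s error_mean rate H K (q s)) ^+ 2 +
       \sum_s (error_second_moment rate H K (q s) - error_mean rate H K (q s) ^+ 2) <= J].
Proof.
pose C1 : R := 1 + \sum_(j < K) `|H j|.
pose Phi (x : I -> nat * nat) := (\sum_s error_stat (fun j => - H j) (x s)) ^+ 2.
have b1 y : `|error_stat (fun j => - H j) y| <= C1.
  rewrite /error_stat (le_trans (ler_normD _ _))// lerD//.
    by case: (_ && _); rewrite /= ?normr1 ?normr0.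
  rewrite normrN; have [Ky|yK] := leqP K y.1.
    by rewrite HK// normr0 sumr_ge0.
  by rewrite (bigD1 (Ordinal yK))//= lerDl sumr_ge0.
have b2 x : 0 <= Phi x <= (\sum_(s : I) C1) ^+ 2.
  rewrite sqr_ge0/= -[leLHS]real_normK ?num_real// lerXn2r ?nnegrE//.
    by apply: sumr_ge0 => s _; exact: le_trans (b1 (0, 0)%N).
  by rewrite (le_trans (ler_norm_sum _ _ _))// ler_sum.
have [J iJ cJ] := integral_counts t0 t0' e tr b2.
have r0 b : 0 < rate b by case: b.
exists J; split => // [B hB|hB].
  exact: (limit_le (weights_trace mu tr) r0 H0 HK hB cJ).
exact: (limit_ge (weights_trace mu tr) r0 H0 HK hB cJ).
Qed.

End second_moment.

(** * The error of a linear estimator as a sum over species *)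

Section pathwise.
Context (R : realType) (S : countType) (mu : probability {fset S} R) (t t' : R).
Context d (Omega : measurableType d) (P : probability Omega R).
Variable e : experiment mu t t' P.
Variable H : nat -> R.
Hypothesis H0 : H 0%N = 0.

Definition seen_species (w : Omega) : {fset S} :=
  (\bigcup_(n <- iota 0 (size1 e w + size2 e w)) draw e n w)%fset.

Lemma count12_eq0 s w : s \notin seen_species w ->
  count1 e s w = 0%N /\ count2 e s w = 0%N.
Proof.
move=> hs; have h n : (n < size1 e w + size2 e w)%N -> (s \in draw e n w) = false.
  move=> nq; apply: contraNF hs => sn; apply/bigfcupP; exists n => //.
  by rewrite mem_iota nq.
split; apply: big1_seq => n /andP[_]; rewrite mem_index_iota => /andP[_ nq].
  by rewrite h// (leq_trans nq)// leq_addr.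
by rewrite h.
Qed.

Lemma error_sum (U : {fset S}) w : {subset seen_species w <= U} ->
  newly_seen e w - linear_estimator e H w =
  \sum_(s <- U) error_stat (fun j => - H j) (count1 e s w, count2 e s w).
Proof.
move=> hU; have h0 s : s \notin U -> count1 e s w = 0%N /\ count2 e s w = 0%N.
  by move=> sU; apply: count12_eq0; apply: contra sU => /hU.
have card (p : S -> bool) : (forall s, p s -> s \in U) ->
    #|` fset_set [set s | p s]| = (\sum_(s <- U) p s)%N.
  move=> pU; have -> : [set s | p s] = [set` [fset s in U | p s]%fset].
    apply/seteqP; split => s /=; rewrite !inE; last by case/andP.
    by move=> ps; rewrite pU.
  rewrite set_fsetK card_fset_sum1 big_fset/= big_mkcond/=.
  by apply: eq_bigr => s _; case: (p s).
rewrite /newly_seen /seen12 /seen1 !card; first last.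
- by move=> s; apply: contraTT => /h0[-> ->].
- by move=> s; apply: contraTT => /h0[-> _].
rewrite /linear_estimator (@fsbigTE _ _ _ _ U); last by move=> s /h0[-> _].
rewrite !natr_sum -!sumrB; apply: eq_bigr => s _; rewrite /error_stat/=; congr (_ - _).
by case: (count1 e s w) => [|a]; rewrite ?add0n ?addSn/= ?subr0 ?subrr.
Qed.

Lemma count1_le s w : (count1 e s w <= size1 e w)%N.
Proof.
rewrite /count1 -[leqRHS]subn0 -[leqRHS]muln1 -sum_nat_const_nat.
by apply: leq_sum => n _; case: (_ \in _).
Qed.

End pathwise.

Section first_species.
Context (S : countType).

(** Only the species with code below k are watched. Indices that are not the
    code of a species are never met. *)
Definition first_species k (A : {fset S}) : {set 'I_k} :=
  [set i : 'I_k | oapp (fun s => s \in A) false (pickle_inv i)]%SET.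

Lemma card_first_species k A : (#|first_species k A| <= #|` A|)%N.
Proof.
pose r := pmap (@pickle_inv S) [seq val i | i <- enum (first_species k A)].
have ur : uniq r.
  apply: (pmap_uniq pickle_invK).
  by rewrite (map_inj_uniq val_inj) enum_uniq.
have sr : size r = #|first_species k A|.
  rewrite size_pmap cardE -[RHS](size_map val); apply/eqP; rewrite -all_count.
  apply/allP => x /mapP[i]; rewrite mem_enum inE => h ->.
  by move: h => /=; case: (pickle_inv _).
rewrite -sr; apply: uniq_leq_size => // s; rewrite mem_pmap => /mapP[x /mapP[i]].
by rewrite mem_enum inE => h -> hs; rewrite -hs in h.
Qed.

End first_species.

Section truncation.
Context (R : realType).
Definition truncate (H : nat -> R) k j : R := if (j < k)%N then H j else 0.
End truncation.

Section pathwise_limit.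
Context (R : realType) (S : countType) (mu : probability {fset S} R) (t t' : R).
Context d (Omega : measurableType d) (P : probability Omega R).
Variable e : experiment mu t t' P.
Variable H : nat -> R.
Hypothesis H0 : H 0%N = 0.

Lemma counts_first k w (i : 'I_k) : counts e (@first_species S k) w i =
  oapp (fun s => (count1 e s w, count2 e s w)) (0, 0)%N (pickle_inv i).
Proof.
rewrite /counts /draw_trace; under eq_bigr do rewrite inE.
under [X in (_, X)]eq_bigr do rewrite inE.
by case: pickle_inv => //=; rewrite !big1.
Qed.

(** Outcome by outcome the truncation to k species and to coefficients of
    index below k is eventually exact, as the draws contain finitely many species
    and no count exceeds the number of draws. *)
Lemma truncated_error w : \forall k \near \oo,
  \sum_i error_stat (fun j => - truncate H k j) (counts e (@first_species S k) w i) =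
  newly_seen e w - linear_estimator e H w.
Proof.
near=> k.
have ck : (size1 e w < k)%N by near: k; exists (size1 e w).+1.
have pk : forall s, s \in seen_species e w -> (choice.pickle s < k)%N.
  near: k; exists (\max_(s <- seen_species e w) (choice.pickle s).+1)%N => // k /= hk s sw.
  by apply: leq_trans hk; rewrite (big_rem s)//= leq_maxl.
pose r := pmap (@pickle_inv S) (iota 0 k).
have ur : uniq r by apply: (pmap_uniq pickle_invK); exact: iota_uniq.
rewrite (@error_sum _ _ _ _ _ _ _ _ e H H0 [fset s in r]%fset); last first.
  move=> s sw; rewrite !inE mem_pmap; apply/mapP; exists (choice.pickle s).
    by rewrite mem_iota/= pk.
  by rewrite pickleK_inv.
have -> : \sum_(s <- [fset s in r]%fset) error_stat (fun j => - H j) (count1 e s w, count2 e s w)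
   = \sum_(s <- r) error_stat (fun j => - H j) (count1 e s w, count2 e s w).
  apply: perm_big; apply: uniq_perm; rewrite ?fset_uniq//.
  by move=> s; apply/imfsetP/idP => [[x xi ->]|ii] //; exists s.
rewrite /r big_pmap (_ : iota 0 k = index_iota 0 k) ?big_mkord; last first.
  by rewrite /index_iota subn0.
apply: eq_bigr => i _; rewrite counts_first; case: pickle_inv => [s|]/=.
  by rewrite /error_stat /truncate/= (leq_ltn_trans (count1_le e s w)).
by rewrite /error_stat /truncate/= H0 if_same oppr0 addr0.
Unshelve. all: by end_near. Qed.

End pathwise_limit.

Lemma limn_einf_le (R : realType) (u : nat -> \bar R) (c : \bar R) :
  (\forall k \near \oo, (u k <= c)%E) -> (limn_einf u <= c)%E.
Proof.
move=> uc; rewrite /limn_einf /limn_esup /limf_esup leeNl.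
apply: le_ereal_inf_tmp => _ [V VF <-].
have [k [Vk uk]] : exists k, V k /\ (u k <= c)%E.
  by have /filter_ex : \forall k \near \oo, V k /\ (u k <= c)%E by apply: filterI.
apply: (@le_trans _ _ (- u k)%E); first by rewrite leeN2.
by apply: ereal_sup_ubound; exists k.
Qed.

(** The type {fset S} is countable. *)
Lemma discrete_null (R : realType) (S : countType) (mu : probability {fset S} R)
    (X : set {fset S}) :
  (forall A, X A -> mu [set A] = 0%E) -> mu X = 0%E.
Proof.
move=> h; apply/eqP; rewrite -measure_le0.
pose F n : set {fset S} :=
  oapp (fun A => if A \in X then [set A] else set0) set0 (pickle_inv n).
have F0 n : mu (F n) = 0%E.
  rewrite /F; case: pickle_inv => [A|]/=; last exact: measure0.
  by case: ifPn => [/set_mem/h//|_]; exact: measure0.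
apply: (@le_trans _ _ (\sum_(0 <= n <oo) mu (F n))%E).
  apply: measure_sigma_subadditive => //.
  move=> A XA; exists (choice.pickle A) => //.
  by rewrite /F pickleK_inv/= mem_set.
by rewrite eseries0.
Qed.

Lemma trace_law_size (R : realType) (S : countType) (mu : probability {fset S} R)
    (I : finType) (tr : {fset S} -> {set I}) B (J : {set I}) :
  size_le B mu -> (forall A, #|tr A| <= #|` A|)%N ->
  trace_law mu tr J != 0 -> (#|J| <= B)%N.
Proof.
move=> hmu htr; apply: contraNT; rewrite -ltnNge => BJ.
rewrite /trace_law discrete_null// => A /= trA; apply: hmu.
by rewrite (leq_trans BJ)// -trA.
Qed.

Lemma sum_marginal_le (R : realType) (I : finType) (v : {set I} -> R) B b :
  weights (fun=> v) -> (forall J, v J != 0 -> (#|J| <= B)%N) ->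
  \sum_s marginal (fun=> v) s b <= B%:R.
Proof.
move=> wv hB; have := sum_marginal (fun=> v) b (fun=> 1 : R).
under [RHS]eq_bigr do rewrite mulr1.
move=> <-; rewrite -[leRHS]mul1r -[X in _ <= X * _](wv true).2 mulr_suml; apply: ler_sum => J _.
have [->|vJ] := eqVneq (v J) 0; first by rewrite !mul0r.
rewrite ler_wpM2l//; first exact: (wv true).1.
by rewrite sumr_const ler_nat hB.
Qed.

(** * The upper bound *)

Section upper.
Context (R : realType) (r t : R) (H : nat -> R).
Hypotheses (r0 : 0 < r) (t0 : 0 < t) (H0 : H 0%N = 0).
Hypothesis sH : summable_at H t.
Hypothesis sH2 : summable_at (fun i => H i ^+ 2) t.

Local Notation rate := (fun b : bool => if b then t else r * t).
Definition mean_profile := profile r t (fun i => - H i).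
Definition second_profile := profile r t (fun i => H i ^+ 2).

Definition mean_gap k := series_tail (fun i => - H i) t k.
Definition second_gap k := series_tail (fun i => H i ^+ 2) t k.

Lemma mean_trunc p k : 0 <= p <= 1 -> (0 < k)%N ->
  `|error_mean rate (truncate H k) k p - mean_profile p| <= p * mean_gap k.
Proof.
move=> p01 k0; have := @poisson_mean_tail R r t (fun i => - H i) p k (ltW t0)
  (summable_atN sH) (etrans (congr1 _ H0) (oppr0 _)) p01 k0.
rewrite /error_mean (_ : (fun j => - truncate H k j) =
  (fun j => if (j < k)%N then - H j else 0))//.
by apply/funext => j; rewrite /truncate; case: ifP => // _; rewrite oppr0.
Qed.

Lemma second_trunc p k : 0 <= p <= 1 -> (0 < k)%N ->
  `|error_second_moment rate (truncate H k) k p - second_profile p| <= p * second_gap k.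
Proof.
move=> p01 k0; have H20 : H 0%N ^+ 2 = 0 by rewrite H0 expr0n.
have := @poisson_mean_tail R r t (fun i => H i ^+ 2) p k (ltW t0) sH2 H20 p01 k0.
rewrite /error_second_moment (_ : (fun j => truncate H k j ^+ 2) =
  (fun j => if (j < k)%N then H j ^+ 2 else 0))//.
by apply/funext => j; rewrite /truncate; case: ifP => // _; rewrite expr0n.
Qed.

Lemma cvg_mean_gap : mean_gap @ \oo --> (0 : R).
Proof. by apply: cvg_series_tail; exact: summable_atN. Qed.

Lemma cvg_second_gap : second_gap @ \oo --> (0 : R).
Proof. exact: cvg_series_tail. Qed.

Lemma cvg_mean_trunc p : 0 <= p <= 1 ->
  error_mean rate (truncate H k) k p @[k --> \oo] --> mean_profile p.
Proof.
move=> p01; have /andP[p0 p1] := p01.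
apply/cvgrPdist_le => eps eps0; near=> k.
have k0 : (0 < k)%N by near: k; exists 1%N.
rewrite distrC (le_trans (mean_trunc p01 k0))//.
have g0 : 0 <= mean_gap k by apply: series_tail_ge0; [exact: ltW|exact: summable_atN].
rewrite (le_trans (ler_piMl g0 p1))//; near: k.
exact: (cvgr_le _ cvg_mean_gap).
Unshelve. all: by end_near. Qed.

Lemma cvg_second_trunc p : 0 <= p <= 1 ->
  error_second_moment rate (truncate H k) k p @[k --> \oo] --> second_profile p.
Proof.
move=> p01; have /andP[p0 p1] := p01.
apply/cvgrPdist_le => eps eps0; near=> k.
have k0 : (0 < k)%N by near: k; exists 1%N.
rewrite distrC (le_trans (second_trunc p01 k0))//.
have g0 : 0 <= second_gap k by apply: series_tail_ge0 => //; exact: ltW.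
rewrite (le_trans (ler_piMl g0 p1))//; near: k.
exact: (cvgr_le _ cvg_second_gap).
Unshelve. all: by end_near. Qed.

Lemma truncate_ge k j : (k <= j)%N -> truncate H k j = 0.
Proof. by rewrite /truncate ltnNge => ->. Qed.

Lemma truncate0 k : truncate H k 0 = 0.
Proof. by rewrite /truncate H0 if_same. Qed.

Lemma mean_profile_sqr_le p : 0 <= p <= 1 -> mean_profile p ^+ 2 <= second_profile p.
Proof.
move=> p01; have cs := cvg_second_trunc p01.
have cm : error_mean rate (truncate H k) k p ^+ 2 @[k --> \oo] --> mean_profile p ^+ 2.
  by rewrite expr2; apply: cvgM; exact: cvg_mean_trunc.
apply: ler_cvg_to cm cs _; near=> k.
have rate0 b : 0 < rate b by case: b => //; exact: mulr_gt0.
exact: (mean_sqr_le rate0 (truncate0 k) (@truncate_ge k) p01).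
Unshelve. all: by end_near. Qed.

(** Fatou's lemma reduces to the truncated errors. There the mean is at most
    sum_s q_s (b + mean_gap k) and the second moments add up to at most
    sum_s q_s (c + second_gap k), where sum_s q_s <= B; the comparison of
    variances accounts for the other factor B. *)
Lemma risk_le (b c : R) (B : nat) (S : countType) (mu : probability {fset S} R)
    d (Omega : measurableType d) (P : probability Omega R)
    (e : experiment mu t (r * t) P) :
  size_le B mu -> 0 <= b -> 0 <= c ->
  (forall p, 0 <= p <= 1 -> `|mean_profile p| <= p * b) ->
  (forall p, 0 <= p <= 1 -> second_profile p <= p * c) ->
  (risk e H <= (B%:R ^+ 2 * (b ^+ 2 + c))%:E)%E.
Proof.
move=> hmu b0 c0 hb hc.
have t0' : 0 < r * t by rewrite mulr_gt0.
pose f k w := \sum_i error_stat (fun j => - truncate H k j)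
  (counts e (@first_species S k) w i).
have bound k : (0 < k)%N -> (\int[P]_w (f k w ^+ 2)%:E <=
    (B%:R ^+ 2 * ((b + mean_gap k) ^+ 2 + (c + second_gap k)))%:E)%E.
  move=> k0.
  have [J [iJ JB _]] := second_moment_counts t0 t0' e (@first_species S k)
    (truncate0 k) (@truncate_ge k).
  rewrite iJ lee_fin.
  have hB J' : trace_law mu (@first_species S k) J' != 0 -> (#|J'| <= B)%N.
    by apply: trace_law_size => //; exact: card_first_species.
  apply: (le_trans (JB _ hB)).
  pose q s := marginal (fun=> trace_law mu (@first_species S k)) s true.
  change ((\sum_s error_mean rate (truncate H k) k (q s)) ^+ 2 + B%:R * \sum_s
    (error_second_moment rate (truncate H k) k (q s) -
     error_mean rate (truncate H k) k (q s) ^+ 2) <=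
    B%:R ^+ 2 * ((b + mean_gap k) ^+ 2 + (c + second_gap k))).
  have wv := weights_trace mu (@first_species S k).
  have q01 s : 0 <= q s <= 1 by rewrite marginal_ge0//= marginal_le1.
  have q0 s : 0 <= q s by case/andP: (q01 s).
  have sq : \sum_s q s <= B%:R by exact: sum_marginal_le.
  have g0 : 0 <= mean_gap k by apply: series_tail_ge0; [exact: ltW|exact: summable_atN].
  have g0' : 0 <= second_gap k by apply: series_tail_ge0 => //; exact: ltW.
  have m s : `|error_mean rate (truncate H k) k (q s)| <= q s * (b + mean_gap k).
    rewrite -[X in `|X|](subrK (mean_profile (q s))) (le_trans (ler_normD _ _))//.
    by rewrite addrC mulrDr lerD ?hb ?mean_trunc.
  have v s : error_second_moment rate (truncate H k) k (q s) <= q s * (c + second_gap k).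
    have := second_trunc (q01 s) k0; rewrite ler_norml => /andP[_].
    have := hc _ (q01 s); lra.
  rewrite mulrDr; apply: lerD.
    rewrite -exprMn -[leLHS]real_normK ?num_real// lerXn2r ?nnegrE//.
      by rewrite mulr_ge0// addr_ge0.
    rewrite (le_trans (ler_norm_sum _ _ _))// (le_trans (ler_sum _ (fun s _ => m s)))//.
    by rewrite -mulr_suml ler_wpM2r// addr_ge0.
  rewrite expr2 -mulrA ler_wpM2l//.
  apply: (@le_trans _ _ (\sum_s q s * (c + second_gap k))).
    by apply: ler_sum => s _; rewrite lerBlDr (le_trans (v s))// lerDl sqr_ge0.
  by rewrite -mulr_suml ler_wpM2r// addr_ge0.
have cv : (fun k => B%:R ^+ 2 * ((b + mean_gap k) ^+ 2 + (c + second_gap k))) @ \oo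
    --> B%:R ^+ 2 * (b ^+ 2 + c).
  apply: cvgMl_tmp; rewrite -[X in X ^+ 2 + _]addr0 -[X in _ + X]addr0.
  apply: cvgD; last by apply: cvgD; [exact: cvg_cst|exact: cvg_second_gap].
  by rewrite !expr2; apply: cvgM; apply: cvgD; [exact: cvg_cst|exact: cvg_mean_gap|
    exact: cvg_cst|exact: cvg_mean_gap].
have mf k : measurable_fun setT (fun w => (f k w ^+ 2)%:E).
  exact: (measurable_counts e (@first_species S k) (fun x : 'I_k -> nat * nat =>
    ((\sum_i error_stat (fun j => - truncate H k j) (x i)) ^+ 2)%:E)).
have -> : risk e H = (\int[P]_w limn_einf (fun k => (f k w ^+ 2)%:E))%E.
  rewrite /risk expectation.unlock; apply: eq_integral => w _.
  rewrite real_normK ?num_real//; apply/esym.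
  have cw : (fun k => (f k w ^+ 2)%:E) @ \oo -->
      (((newly_seen e w - linear_estimator e H w) ^+ 2)%:E).
    apply: cvg_near_cst; near=> k; rewrite /f.
    by have -> : \sum_i error_stat (fun j => - truncate H k j)
        (counts e (@first_species S k) w i) =
      newly_seen e w - linear_estimator e H w by near: k; exact: truncated_error.
  by rewrite (cvg_limn_einf_sup cw).
apply: (le_trans (fatou P measurableT mf _)); first by move=> k w _; rewrite lee_fin sqr_ge0.
apply/lee_addgt0Pr => eps eps0; apply: limn_einf_le.
near=> k; apply: (le_trans (bound k _)); first by near: k; exists 1%N.
rewrite -EFinD lee_fin; near: k.
have /cvgr_le := cv; apply; by rewrite ltrDl.
Unshelve. all: by end_near. Qed.

End upper.

(** * An expanding map of the unit interval *)

Section bernoulli_shift.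
Context (R : realType).
Local Notation leb := (@lebesgue_measure R).

Definition affine (a b : R) (x : measurableTypeR R) : measurableTypeR R := (x - b) / a.

Lemma measurable_affine a b : measurable_fun setT (affine a b).
Proof. by apply: measurable_funM => //; apply: measurable_funB. Qed.

(** Uniqueness of Lebesgue measure, checked on half-open intervals. *)
Lemma lebesgue_affine a b (Y : set (measurableTypeR R)) : 0 < a -> measurable Y ->
  leb (affine a b @^-1` Y) = (a%:E * leb Y)%E.
Proof.
move=> a0 mY; have ia0 : 0 <= a^-1 by rewrite invr_ge0 ltW.
have [m0 m0E] : exists m : {measure set (measurableTypeR R) -> \bar R},
    forall X, m X = leb (affine a b @^-1` X).
  unshelve eexists; first (apply: (pushforward leb (affine a b))).
    exact: measurable_affine.
  by [].
pose m := mscale (NngNum ia0) m0.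
have mE X : m X = (a^-1%:E * leb (affine a b @^-1` X))%E by rewrite -m0E.
suff -> : leb Y = m Y.
  by rewrite mE muleA -EFinM divff ?gt_eqF// mul1e.
apply: (lebesgue_measure_unique (mu := m)) => // X [[x y] _ <-].
rewrite [RHS]mE /=.
have -> : affine a b @^-1` `]x, y]%classic = `](b + a * x), (b + a * y)]%classic.
  apply/seteqP; split => z; rewrite /= !in_itv/= /affine.
    by rewrite ltr_pdivlMr// ler_pdivrMr// ltrBrDl lerBlDl !(mulrC _ a).
  by rewrite ltr_pdivlMr// ler_pdivrMr// ltrBrDl lerBlDl !(mulrC _ a).
rewrite !lebesgue_measure_itv/= !lte_fin ltrD2l ltr_pM2l//.
case: ifP => _; last by rewrite mule0.
by rewrite -!EFinD -EFinM; congr EFin; field; rewrite gt_eqF.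
Qed.

(** The interval [0, sum ps[ is cut into consecutive cells of lengths ps.
    This is the number of the cell that contains x; expand maps each cell
    affinely onto [0, 1[. *)
Fixpoint cell_index (ps : seq R) (x : R) : nat :=
  if ps is p :: ps' then (if x < p then 0%N else (cell_index ps' (x - p)).+1) else 0%N.

Fixpoint expand (ps : seq R) (x : measurableTypeR R) : measurableTypeR R :=
  if ps is p :: ps' then (if x < p then affine p 0 x else expand ps' (affine 1 p x))
  else 0.

Lemma measurable_expand ps : measurable_fun setT (expand ps).
Proof.
elim: ps => [|p ps IH] /=; first exact: measurable_cst.
apply: measurable_fun_ifT.
- exact: measurable_fun_ltr.
- exact: measurable_affine.
- by apply: (measurableT_comp IH); exact: measurable_affine.
Qed.

Lemma measurable_cell_index ps :
  measurable_fun setT (cell_index ps : measurableTypeR R -> nat).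
Proof.
elim: ps => [|p ps IH] /=; first exact: measurable_cst.
apply: measurable_fun_ifT.
- exact: measurable_fun_ltr.
- exact: measurable_cst.
- apply: (measurableT_comp (f := succn)) => //.
  rewrite (_ : (fun x => cell_index ps (x - p)) = cell_index ps \o affine 1 p).
    by apply: (measurableT_comp IH); exact: measurable_affine.
  by apply/funext => x; rewrite /affine/= divr1.
Qed.

Lemma measurable_cell ps (c : R) (D : set (measurableTypeR R)) j : measurable D ->
  measurable [set x : measurableTypeR R |
    [/\ 0 <= x < c, cell_index ps x = j & D (expand ps x)]].
Proof.
move=> mD; rewrite (_ : [set x | _] = `[0%R, c[%classic `&`
    (cell_index ps @^-1` [set j] `&` expand ps @^-1` D)).
  apply: measurableI => //; apply: measurableI.
    by rewrite -[X in measurable X]setTI; exact: measurable_cell_index.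
  by rewrite -[X in measurable X]setTI; exact: measurable_expand.
by apply/seteqP; split => x /=; rewrite in_itv/=; [case=> ? ? ?|case=> ? [? ?]].
Qed.

(** Each cell is an affine copy of [0, 1[. The cells are peeled off one at a
    time, the remaining ones being shifted back to the origin. *)
Lemma cell_law ps (D : set (measurableTypeR R)) j :
  (forall p, p \in ps -> 0 <= p) -> measurable D -> (j < size ps)%N ->
  leb [set x : measurableTypeR R |
    [/\ 0 <= x < \sum_(p <- ps) p, cell_index ps x = j & D (expand ps x)]] =
  ((nth 0 ps j)%:E * leb (D `&` `[0%R, 1%R[))%E.
Proof.
elim: ps j => // p ps IH j ps0 mD jps.
have p0 : 0 <= p by apply: ps0; rewrite mem_head.
have ps0' q : q \in ps -> 0 <= q by move=> qps; apply: ps0; rewrite inE qps orbT.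
have mD' : measurable (D `&` `[0%R, 1%R[) by apply: measurableI.
case: j jps => [_|j jps] /=.
  have [p00|pn0] := eqVneq p 0.
    rewrite p00 mul0e; rewrite (_ : [set x | _] = set0) ?measure0//.
    rewrite -subset0 => x /= [/andP[x0 _]]; rewrite ltNge x0; by [].
  rewrite -(lebesgue_affine 0)//; last by rewrite lt_neqAle eq_sym pn0.
  have pp : 0 < p by rewrite lt_neqAle eq_sym pn0.
  congr (leb _); apply/seteqP; split => x /=.
    move=> [/andP[x0 _]]; case: ifP => // xp _ Dx; split=> //.
    by rewrite in_itv/= /affine subr0 divr_ge0//= ltr_pdivrMr// mul1r.
  rewrite in_itv/= /affine subr0 => -[Dx /andP[]].
  rewrite ler_pdivlMr// mul0r ltr_pdivrMr// mul1r => x0 xp.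
  rewrite x0 xp big_cons; split => //.
  by rewrite (lt_le_trans xp)// lerDl big_seq sumr_ge0.
rewrite -(IH j)//; pose Z := [set x : measurableTypeR R |
  [/\ 0 <= x < \sum_(p <- ps) p, cell_index ps x = j & D (expand ps x)]].
rewrite -/Z.
rewrite -[RHS]mul1e -(lebesgue_affine p ltr01); last exact: measurable_cell.
congr (leb _); apply/seteqP; split => x; rewrite /Z/= /affine divr1 big_cons.
  move=> [/andP[x0 xs]]; case: ltrP => // px [<-] Dx; split => //.
  by rewrite subr_ge0 px ltrBlDl.
move=> [/andP[]]; rewrite subr_ge0 ltrBlDl => px xs xj Dx.
have -> : (x < p) = false by apply/negbTE; rewrite -leNgt.
by rewrite xs (le_trans p0 px) xj.
Qed.

End bernoulli_shift.

Section unit_interval.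
Context (R : realType).
Local Notation leb := (@lebesgue_measure R).

Let munit : measurable (`[0%R, 1%R[%classic : set (measurableTypeR R)).
Proof. exact: measurable_itv. Qed.

Definition unit_prob : set (measurableTypeR R) -> \bar R := mrestr leb munit.
HB.instance Definition _ := Measure.on unit_prob.

Let unit_prob_setT : unit_prob setT = 1%E.
Proof.
by rewrite /unit_prob /mrestr setTI lebesgue_measure_itv/= lte_fin ltr01 oppr0 adde0.
Qed.

HB.instance Definition _ := Measure_isProbability.Build _ _ _ unit_prob unit_prob_setT.

Lemma unit_probE (D : set (measurableTypeR R)) : unit_prob D = leb (D `&` `[0%R, 1%R[%classic).
Proof. by []. Qed.

End unit_interval.

Lemma cell_index_lt (R : realType) (ps : seq R) x :
  0 <= x < \sum_(p <- ps) p -> (cell_index ps x < size ps)%N.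
Proof.
elim: ps x => [|p qs IH] x /=.
  by rewrite big_nil => /andP[x0 /(le_lt_trans x0)]; rewrite ltxx.
rewrite big_cons => /andP[x0 xs]; case: ltrP => // px; rewrite ltnS IH//.
by rewrite subr_ge0 px ltrBlDl.
Qed.

(** * An i.i.d. sequence of random sets *)

Section iid.
Context (R : realType) (S : countType) (ps : seq R) (As : seq {fset S}).
Hypothesis ps0 : forall p, p \in ps -> 0 <= p.
Hypothesis ps1 : \sum_(p <- ps) p = 1.

Local Notation P0 := (@unit_prob R).

Definition sampled_set (x : measurableTypeR R) : {fset S} := nth fset0 As (cell_index ps x).

Lemma measurable_sampled_set : measurable_fun setT sampled_set.
Proof.
by apply: (measurableT_comp (f := nth fset0 As)) => //; exact: measurable_cell_index.
Qed.

Definition sampled_law (B : set {fset S}) : R :=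
  \sum_(j < size ps | nth fset0 As j \in B) nth 0 ps j.

(** The position of a uniform point inside its cell is again uniform and
    independent of the cell. *)
Lemma sampled_set_expand (B : set {fset S}) (D : set (measurableTypeR R)) : measurable D ->
  P0 (sampled_set @^-1` B `&` expand ps @^-1` D) = ((sampled_law B)%:E * P0 D)%E.
Proof.
move=> mD; pose F (j : 'I_(size ps)) := [set x : measurableTypeR R |
    [/\ 0 <= x < \sum_(p <- ps) p, cell_index ps x = j & D (expand ps x)]].
have -> : P0 (sampled_set @^-1` B `&` expand ps @^-1` D) =
    @lebesgue_measure R (\big[setU/set0]_(j < size ps | nth fset0 As j \in B) F j).
  rewrite unit_probE; congr (@lebesgue_measure R _).
  rewrite -bigcup_pred; apply/seteqP; split => x.
    rewrite /= in_itv/= -ps1 => -[[Bx Dx] x01].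
    exists (Ordinal (cell_index_lt x01)) => //=.
    by rewrite unfold_in/=; apply/mem_set.
  move=> [j /=]; rewrite unfold_in/= => /set_mem Bj []; rewrite ps1 => x01 xj Dx.
  by rewrite /sampled_set xj.
rewrite measure_bigsetU_ord_cond.
- rewrite /sampled_law -sumEFin ge0_sume_distrl; last first.
    by move=> j _; rewrite lee_fin; apply/ps0/mem_nth.
  by apply: eq_bigr => j _; exact: cell_law.
- by move=> j _; exact: measurable_cell.
- move=> j j' _ _ [x [[_ h _] [_ h' _]]]; apply: val_inj.
  by rewrite /= -h -h'.
Qed.

Lemma unit_prob_sampled_set (B : set {fset S}) : P0 (sampled_set @^-1` B) = (sampled_law B)%:E.
Proof.
have := @sampled_set_expand B setT measurableT.
by rewrite preimage_setT setIT probability_setT mule1.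
Qed.

Lemma sampled_lawT : sampled_law setT = 1.
Proof.
by apply: EFin_inj; rewrite -unit_prob_sampled_set preimage_setT probability_setT.
Qed.

Definition nth_sample i (x : measurableTypeR R) : {fset S} := sampled_set (iter i (expand ps) x).

Lemma measurable_iter_expand i : measurable_fun setT (iter i (expand ps)).
Proof.
elim: i => [|i IH] /=; first exact: measurable_id.
exact: (measurableT_comp (measurable_expand ps) IH).
Qed.

Lemma measurable_nth_sample i : measurable_fun setT (nth_sample i).
Proof. exact: (measurableT_comp measurable_sampled_set (measurable_iter_expand i)). Qed.

Lemma measurable_samples N (B : nat -> set {fset S}) :
  measurable [set x | forall i, (i < N)%N -> B i (nth_sample i x)].
Proof.
rewrite (_ : [set x | _] = \bigcap_(i < N) (nth_sample i @^-1` B i)).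
  apply: bigcap_measurableType => i _.
  by rewrite -[X in measurable X]setTI; exact: measurable_nth_sample.
by [].
Qed.

(** Iterating sampled_set_expand: the cell of x is independent of the rest of
    its itinerary, which is the itinerary of the uniform point expand ps x. *)
Lemma samples_law N (B : nat -> set {fset S}) :
  P0 [set x | forall i, (i < N)%N -> B i (nth_sample i x)] =
  (\prod_(i < N) sampled_law (B i))%:E.
Proof.
elim: N B => [|N IH] B.
  by rewrite big_ord0 (_ : [set x | _] = setT) ?probability_setT// -subTset.
rewrite (_ : [set x | _] = sampled_set @^-1` B 0%N `&`
    expand ps @^-1` [set x | forall i, (i < N)%N -> B i.+1 (nth_sample i x)]).
  rewrite sampled_set_expand; last exact: (measurable_samples N (fun i => B i.+1)).
  by rewrite (IH (fun i => B i.+1)) big_ord_recl.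
apply/seteqP; split => x /=.
  move=> h; split; first exact: (h 0%N).
  by move=> i iN; have := h i.+1 iN; rewrite /nth_sample iterSr.
by move=> [h0 h] [|i] // iN; have := h i iN; rewrite /nth_sample -iterSr.
Qed.

End iid.

(** * Existence of the experiment *)

Section construction.
Context (R : realType) (S : countType) (ps : seq R) (As : seq {fset S}).
Hypothesis ps0 : forall p, p \in ps -> 0 <= p.
Hypothesis ps1 : \sum_(p <- ps) p = 1.
Context (t t' : R) (t0 : 0 < t) (t0' : 0 < t').

Local Notation P0 := (@unit_prob R).
Let space := (measurableTypeR R * (nat * nat))%type.
Let P : probability space R :=
  (P0 \x (poisson_prob t 0%N \x poisson_prob t' 0%N))%E.

Let sampleRV : {RV P0 >-> {fset S}} := mfun_Sub (mem_set (measurable_sampled_set ps As)).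

Let mu : probability {fset S} R := distribution P0 sampleRV.

Let drawf i (w : space) : {fset S} := nth_sample ps As i w.1.
Let size1f (w : space) : nat := w.2.1.
Let size2f (w : space) : nat := w.2.2.

Let mdraw i : measurable_fun setT (drawf i).
Proof. exact: (measurableT_comp (measurable_nth_sample ps As i) measurable_fst). Qed.

Let msize1 : measurable_fun setT size1f.
Proof. exact: (measurableT_comp measurable_fst measurable_snd). Qed.

Let msize2 : measurable_fun setT size2f.
Proof. exact: (measurableT_comp measurable_snd measurable_snd). Qed.

Let PE (D : set (measurableTypeR R)) (A A' : set nat) : measurable D ->
  P (D `*` (A `*` A')) = (P0 D * (poisson_prob t 0%N A * poisson_prob t' 0%N A'))%E.
Proof.
move=> mD; rewrite [LHS]product_measure1E//; last exact: measurableX.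
by congr (_ * _)%E; exact: product_measure1E.
Qed.

Let muE B : mu B = (sampled_law ps As B)%:E.
Proof. by rewrite -(unit_prob_sampled_set As ps0 ps1). Qed.

Let poissonE (x : R) k : 0 < x -> poisson_prob x 0%N [set k] = (poisson_pmf x k)%:E.
Proof.
by move=> x0; rewrite /poisson_prob x0 esum_set1// lee_fin poisson_pmf_ge0.
Qed.

Let nth_sample_law i B : P0 (nth_sample ps As i @^-1` B) = (sampled_law ps As B)%:E.
Proof.
have := @samples_law _ _ _ As ps0 ps1 i.+1 (fun j => if j == i then B else setT).
rewrite big_ord_recr/= eqxx big1 ?mul1r; last first.
  by move=> j _; rewrite ltn_eqF// (sampled_lawT As ps0 ps1).
move=> <-; congr (P0 _); apply/seteqP; split => x /=.
  by move=> Bx j _; case: eqP => [->|].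
by move=> /(_ i (ltnSn i)); rewrite eqxx.
Qed.

Let drawE i B : P (drawf i @^-1` B) = (sampled_law ps As B)%:E.
Proof.
have -> : drawf i @^-1` B = (nth_sample ps As i @^-1` B) `*` (setT `*` setT).
  by apply/seteqP; split => -[x [n m]] //= [].
rewrite PE; last by rewrite -[X in measurable X]setTI; exact: measurable_nth_sample.
by rewrite nth_sample_law !probability_setT !mule1.
Qed.

Let size1E A : P (size1f @^-1` A) = poisson_prob t 0%N A.
Proof.
have -> : size1f @^-1` A = setT `*` (A `*` setT).
  by apply/seteqP; split => -[x [n m]] //= [_ []].
by rewrite PE// !probability_setT mule1 mul1e.
Qed.

Let size2E A : P (size2f @^-1` A) = poisson_prob t' 0%N A.
Proof.
have -> : size2f @^-1` A = setT `*` (setT `*` A).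
  by apply/seteqP; split => -[x [n m]] //= [_ []].
by rewrite PE// !probability_setT !mul1e.
Qed.

Let drawRV i : {RV P >-> {fset S}} := mfun_Sub (mem_set (mdraw i)).
Let size1RV : {RV P >-> nat} := mfun_Sub (mem_set msize1).
Let size2RV : {RV P >-> nat} := mfun_Sub (mem_set msize2).

Let fam (j : nat + bool) : set (set space) := match j with
   | inl i => events_of (drawRV i)
   | inr true => events_of size1RV
   | inr false => events_of size2RV
   end.

Let indep : mutually_independent P fam.
Proof.
move=> J E hE.
have /choice[B hB] : forall i, exists B : set {fset S},
    if inl i \in J then E (inl i) = drawf i @^-1` B else B = setT.
  move=> i; case: (boolP (inl i \in J)) => [iJ|_]; last by exists setT.
  by have [B _ <-] := hE _ iJ; exists B.
have [A1 hA1] : exists A : set nat,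
    if inr true \in J then E (inr true) = size1f @^-1` A else A = setT.
  case: (boolP (inr true \in J)) => [iJ|_]; last by exists setT.
  by have [B' _ <-] := hE _ iJ; exists B'.
have [A2 hA2] : exists A : set nat,
    if inr false \in J then E (inr false) = size2f @^-1` A else A = setT.
  case: (boolP (inr false \in J)) => [iJ|_]; last by exists setT.
  by have [B' _ <-] := hE _ iJ; exists B'.
pose N := (\max_(j <- J) (if j is inl i then i.+1 else 0))%N.
have NJ i : inl i \in J -> (i < N)%N.
  by move=> iJ; rewrite /N (big_rem (inl i))//= leq_maxl.
(* unconstrained variables are constrained to setT, so that the event becomes
   a rectangle *)
have capE : \bigcap_(i in [set` J]) E i =
    [set x | forall i, (i < N)%N -> B i (nth_sample ps As i x)] `*` (A1 `*` A2).
  apply/seteqP; split => -[x [n m]] /=.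
    move=> h; split; last split.
    - move=> i _; have := hB i; case: ifPn => [iJ EB|_ ->//].
      by have := h _ iJ; rewrite EB.
    - by have := hA1; case: ifPn => [iJ EB|_ ->//]; have := h _ iJ; rewrite EB.
    - by have := hA2; case: ifPn => [iJ EB|_ ->//]; have := h _ iJ; rewrite EB.
  move=> [h [h1 h2]] [i|[]] /= iJ.
  - by have := hB i; rewrite iJ => ->; apply: h; exact: NJ.
  - by have := hA1; rewrite iJ => ->.
  - by have := hA2; rewrite iJ => ->.
rewrite capE PE; last exact: measurable_samples.
rewrite (samples_law As ps0 ps1).
pose L : seq (nat + bool) := inr true :: inr false :: map inl (iota 0 N).
have uL : uniq L.
  rewrite /L /= map_inj_uniq ?iota_uniq ?andbT; last by move=> ? ? [].
  by rewrite inE/=; apply/andP; split; apply/mapP => -[].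
pose F j : \bar R := if j \in J then P (E j) else 1%E.
have F1 : F (inr true) = poisson_prob t 0%N A1.
  rewrite /F; have := hA1; case: ifP => _ ->; first exact: size1E.
  by rewrite probability_setT.
have F2 : F (inr false) = poisson_prob t' 0%N A2.
  rewrite /F; have := hA2; case: ifP => _ ->; first exact: size2E.
  by rewrite probability_setT.
have F3 i : F (inl i) = (sampled_law ps As (B i))%:E.
  rewrite /F; have := hB i; case: ifP => _ ->; first exact: drawE.
  by rewrite (sampled_lawT As ps0 ps1).
have -> : (\prod_(j <- J) P (E j) = \prod_(j <- L) F j)%E.
  rewrite /F -big_mkcond/= -[RHS]big_filter.
  apply: perm_big; apply: uniq_perm; rewrite ?fset_uniq ?filter_uniq// => j.
  rewrite mem_filter; case: (boolP (j \in J)) => //= jJ; apply/esym.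
  case: j jJ => [i|[]] jJ; rewrite /L !inE//=.
  by rewrite mem_map ?mem_iota ?NJ// => ? ? [].
rewrite /L !big_cons F1 F2 big_map -prodEFin [LHS]muleC -muleA; congr (_ * (_ * _))%E.
rewrite -(big_mkord xpredT (fun i => (sampled_law ps As (B i))%:E)) /index_iota subn0.
by apply: eq_bigr => i _; rewrite F3.
Qed.

Let exper : experiment mu t t' P.
Proof.
apply: (@Experiment R S mu t t' _ space P drawRV size1RV size2RV).
- by move=> i B; rewrite muE; exact: drawE.
- by move=> k; rewrite -poissonE//; exact: size1E.
- by move=> k; rewrite -poissonE//; exact: size2E.
- exact: indep.
Defined.

Lemma experiment_exists : exists (mu : probability {fset S} R) (d : measure_display)
    (Omega : measurableType d) (P : probability Omega R) (e : experiment mu t t' P),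
  (forall B, mu B = (sampled_law ps As B)%:E) /\ (forall i w, exists j, draw e i w = nth fset0 As j).
Proof.
exists mu, _, space, P, exper; split; first exact: muE.
by move=> i w; eexists; reflexivity.
Qed.

End construction.

(** * Disjoint blocks of species *)

Section blocks.
Context (R : realType) (n B : nat) (p : 'I_n -> R).
Hypothesis p0 : forall i, 0 <= p i.
Hypothesis p1 : \sum_i p i <= 1.

Definition block_species : countType := ('I_n * 'I_B.+1)%type.

Definition block (i : 'I_n) : {fset block_species} := [fset (i, b) | b in 'I_B.+1]%fset.

(** The mass that the blocks leave over is given to the empty set. *)
Definition block_weights : seq R := 1 - \sum_i p i :: [seq p i | i <- enum 'I_n].
Definition block_sets : seq {fset block_species} := fset0 :: [seq block i | i <- enum 'I_n].

(** A set of species in the support is empty or a block, so it is determined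
    by the element that each block contributes with second component ord0. *)
Definition blocks_met (A : {fset block_species}) : {set 'I_n} := [set i | (i, ord0) \in A]%SET.

Lemma in_block i j b : ((j, b) : block_species) \in block i = (j == i).
Proof.
apply/imfsetP/eqP => [[b' _ [-> _]]//|->]; by exists b.
Qed.

Lemma blocks_met_block i : blocks_met (block i) = [set i]%SET.
Proof. by apply/setP => j; rewrite !inE in_block. Qed.

Lemma blocks_met0 : blocks_met fset0 = finset.set0.
Proof. by apply/setP => j; rewrite !inE. Qed.

Lemma card_block i : #|` block i| = B.+1.
Proof.
rewrite card_in_imfset/=; last by move=> b b' _ _ [].
by rewrite -cardE card_ord.
Qed.

Lemma nth_block_sets j : nth fset0 block_sets j = fset0 \/
  exists i, nth fset0 block_sets j = block i.
Proof.
case: j => [|j]; first by left.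
rewrite /=; have [jn|jn] := ltnP j n; last first.
  by left; rewrite nth_default// size_map size_enum_ord.
right; exists (Ordinal jn); rewrite (nth_map (Ordinal jn)) ?size_enum_ord//.
by congr block; apply: val_inj; rewrite /= nth_enum_ord.
Qed.

Lemma sum_block_sets (F : {fset block_species} -> bool) :
  \sum_(j < size block_weights | F (nth fset0 block_sets j)) nth 0 block_weights j
  = (if F fset0 then 1 - \sum_i p i else 0) + \sum_(i | F (block i)) p i.
Proof.
rewrite big_mkcond/= size_map size_enum_ord big_ord_recl/=; congr (_ + _).
rewrite [RHS]big_mkcond/=; apply: eq_bigr => i _.
rewrite /block_sets /block_weights/= add0n.
by rewrite (nth_map i) ?size_enum_ord// (nth_map i) ?size_enum_ord// nth_ord_enum.
Qed.

(** The last clause is pointwise, not almost sure: in the constructed experiment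
    every draw is empty or a block. *)
Lemma blocks_exist (t t' : R) : 0 < t -> 0 < t' ->
  exists (mu : probability {fset block_species} R) (d : measure_display)
    (Omega : measurableType d) (P : probability Omega R) (e : experiment mu t t' P),
  [/\ size_le B.+1 mu, \sum_i p i = 1 -> mu [set fset0] = 0%E,
   forall J, trace_law mu blocks_met J != 0 -> (#|J| <= 1)%N,
   forall i, marginal (fun=> trace_law mu blocks_met) i true = p i
   & forall i b k w, ((i, b) : block_species) \in draw e k w = (i \in blocks_met (draw e k w))].
Proof.
move=> t0 t0'.
have ps0 q : q \in block_weights -> 0 <= q.
  rewrite inE => /orP[/eqP ->|/mapP[i _ ->]]; by rewrite ?subr_ge0.
have ps1 : \sum_(q <- block_weights) q = 1.
  by rewrite big_cons big_map big_enum subrK.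
have [mu [d [T [P [e [muE drawE]]]]]] :=
  experiment_exists block_sets ps0 ps1 t0 t0'.
exists mu, d, T, P, e.
have muF (F : {fset block_species} -> bool) : mu [set A | F A] =
    ((if F fset0 then 1 - \sum_i p i else 0) + \sum_(i | F (block i)) p i)%:E.
  rewrite muE /sampled_law -sum_block_sets; congr EFin; apply: eq_bigl => j.
  by apply/idP/idP => [/set_mem|/mem_set].
have trE J : trace_law mu blocks_met J =
    (if finset.set0 == J then 1 - \sum_i p i else 0) + \sum_(i | [set i]%SET == J) p i.
  apply: EFin_inj; rewrite -trace_lawE.
  rewrite (_ : _ @^-1` _ = [set A | blocks_met A == J]); last first.
    by apply/seteqP; split => A /= /eqP.
  by rewrite muF blocks_met0; congr (_ + _)%:E; apply: eq_bigl => i; rewrite blocks_met_block.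
split.
- move=> A BA; rewrite (_ : [set A] = [set A' | A' == A]); last first.
    by apply/seteqP; split => A' /= /eqP.
  rewrite muF eq_sym; case: eqP BA => [->|_] BA; first by rewrite cardfs0 in BA.
  rewrite add0r big1// => i /eqP bA; by move: BA; rewrite -bA card_block ltnn.
- move=> sp1; rewrite (_ : [set fset0] = [set A' | A' == fset0]); last first.
    by apply/seteqP; split => A' /= /eqP.
  rewrite muF eqxx sp1 subrr add0r big1// => i /eqP b0.
  by have := card_block i; rewrite b0 cardfs0.
- move=> J; rewrite trE; apply: contraNT; rewrite -ltnNge => J1.
  have /negPf -> : finset.set0 != J by apply: contraTneq J1 => <-; rewrite cards0.
  rewrite add0r big1// => i /eqP iJ; by move: J1; rewrite -iJ cards1.
- move=> i; rewrite /marginal; under eq_bigr do rewrite trE.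
  rewrite big_split/= big1 ?add0r; last first.
    by move=> J iJ; case: eqP => // J0; move: iJ; rewrite -J0 inE.
  under eq_bigr do rewrite big_mkcond/=.
  rewrite exchange_big/= (bigD1 i)//= (bigD1 [set i]%SET) ?inE//= eqxx.
  rewrite big1 ?addr0; last by move=> J /andP[_ /negPf Ji]; rewrite eq_sym Ji.
  rewrite big1 ?addr0// => j ji; rewrite big1// => J iJ; case: eqP => // jJ.
  by move: iJ; rewrite -jJ inE eq_sym (negPf ji).
- move=> i b k w; have [j ->] := drawE k w; rewrite inE.
  by have [->|[i' ->]] := nth_block_sets j; rewrite ?in_block ?inE.
Qed.

End blocks.

(** * The risk of block designs *)

Section block_risk.
Context (R : realType) (n B : nat) (r t : R) (H : nat -> R).
Hypotheses (r0 : 0 < r) (t0 : 0 < t) (H0 : H 0%N = 0).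
Let t0' : 0 < r * t. Proof. exact: mulr_gt0. Qed.
Local Notation rate := (fun b : bool => if b then t else r * t).

Context (mu : probability {fset block_species n B} R)
    d (Omega : measurableType d) (P : probability Omega R)
    (e : experiment mu t (r * t) P).
Local Notation tr := (@blocks_met n B).
Local Notation cnt := (counts e tr).
Hypothesis single : forall J, trace_law mu tr J != 0 -> (#|J| <= 1)%N.
Hypothesis draw_blocks : forall i b k w,
  ((i, b) : block_species n B) \in draw e k w = (i \in tr (draw e k w)).

Let q i := marginal (fun=> trace_law mu tr) i true.
Let q01 i : 0 <= q i <= 1.
Proof.
have wv := weights_trace mu tr.
by rewrite marginal_ge0//= marginal_le1.
Qed.

Lemma block_error w : newly_seen e w - linear_estimator e H w =
  B.+1%:R * \sum_i error_stat (fun j => - H j) (cnt w i).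
Proof.
rewrite (@error_sum _ _ _ _ _ _ _ _ e H H0 [fset s in index_enum ('I_n * 'I_B.+1)%type]%fset);
  last by move=> s _; apply/imfsetP; exists s => //=; rewrite mem_index_enum.
transitivity (\sum_(s : 'I_n * 'I_B.+1)
    error_stat (fun j => - H j) (count1 e (s : block_species n B) w, count2 e (s : block_species n B) w)).
  apply: perm_big; apply: uniq_perm; rewrite ?fset_uniq ?index_enum_uniq//.
  by move=> s; rewrite mem_index_enum; apply/imfsetP; exists s => //=; rewrite mem_index_enum.
transitivity (\sum_i \sum_(b < B.+1) error_stat (fun j => - H j)
    (count1 e ((i, b) : block_species n B) w, count2 e ((i, b) : block_species n B) w)).
  by rewrite pair_bigA; apply: eq_bigr => -[i b].
rewrite mulr_sumr.
apply: eq_bigr => i _.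
rewrite (eq_bigr (fun=> error_stat (fun j => - H j) (cnt w i))).
  by rewrite sumr_const card_ord mulr_natl.
move=> b _; congr error_stat; rewrite /counts /count1 /count2 /draw_trace.
by congr (_, _); apply: eq_bigr => k _; rewrite draw_blocks.
Qed.

Lemma risk_block : risk e H =
  ((B.+1%:R ^+ 2)%:E * \int[P]_w ((\sum_i error_stat (fun j => - H j) (cnt w i)) ^+ 2)%:E)%E.
Proof.
rewrite /risk expectation.unlock -ge0_integralZl_EFin//.
- by apply: eq_integral => w _; rewrite real_normK ?num_real// block_error exprMn EFinM.
- by move=> w _; rewrite lee_fin sqr_ge0.
- exact: (measurable_counts e tr (fun x : 'I_n -> nat * nat =>
    ((\sum_i error_stat (fun j => - H j) (x i)) ^+ 2)%:E)).
Qed.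

Lemma integral_stat (u : nat -> R) K i : (forall j, 0 <= u j) ->
  (forall j, (K <= j)%N -> u j = 0) ->
  (\int[P]_w (error_stat u (cnt w i))%:E = (poisson_mean rate u K (q i))%:E)%E.
Proof.
move=> u0 uK; pose C := 1 + \sum_(j < K) u j.
have b y : 0 <= error_stat u y <= C.
  rewrite /error_stat addr_ge0//=; apply: lerD; first by case: (_ && _).
  have [Ky|yK] := leqP K y.1; first by rewrite uK// sumr_ge0.
  by rewrite (bigD1 (Ordinal yK))//= lerDl sumr_ge0.
have [J -> cJ] := integral_counts t0 t0' e tr (fun x => b (x i)).
congr EFin; apply: (cvg_unique _ cJ) => //.
have rate0 c : 0 < rate c by case: c.
have := cvg_species_avg_stat rate0 (andP (q01 i)).1 uK.
apply: cvg_trans; apply: near_eq_cvg; near=> M.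
have wv := weights_trace mu tr.
have ht : forall b, 0 <= slot_prob rate M b <= 1 by near: M; exact: slot_prob_bound.
rewrite /slot_avg avg_coord; last exact: weights_lazy_weights.
rewrite /no_count; congr species_avg; apply/funext => c; by rewrite marginal_lazy_weights.
Unshelve. all: by end_near. Qed.

Lemma error_stat_mono (u v : nat -> R) y : (forall j, u j <= v j) -> error_stat u y <= error_stat v y.
Proof. by move=> uv; rewrite /error_stat lerD2l. Qed.

Hypothesis sH : summable_at H t.
Hypothesis sH2 : summable_at (fun i => H i ^+ 2) t.
Local Notation m := (mean_profile r t H).
Local Notation s := (second_profile r t H).

Let mstat (u : nat -> R) i : measurable_fun setT (fun w => (error_stat u (cnt w i))%:E).
Proof. exact: (measurable_counts e tr (fun x : 'I_n -> nat * nat => (error_stat u (x i))%:E)). Qed.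

(** Fatou's lemma along the truncations of H, whose means are bounded. *)
Lemma integral_second_lty i : (\int[P]_w (error_stat (fun j => H j ^+ 2) (cnt w i))%:E < +oo)%E.
Proof.
pose f k w := (error_stat (fun j => truncate H k j ^+ 2) (cnt w i))%:E : \bar R.
have -> : (\int[P]_w (error_stat (fun j => H j ^+ 2) (cnt w i))%:E =
    \int[P]_w limn_einf (f ^~ w))%E.
  apply: eq_integral => w _; apply/esym.
  have cw : (f ^~ w) @ \oo --> (error_stat (fun j => H j ^+ 2) (cnt w i))%:E.
    apply: cvg_near_cst; near=> k; rewrite /f /error_stat /truncate.
    suff -> : ((cnt w i).1 < k)%N by [].
    by near: k; exists (cnt w i).1.+1.
  by rewrite (cvg_limn_einf_sup cw).
have f0 k w : (0 <= f k w)%E.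
  by rewrite lee_fin /error_stat addr_ge0// sqr_ge0.
have mf k : measurable_fun setT (f k) by exact: mstat.
apply: (le_lt_trans (fatou P measurableT mf (fun k w _ => f0 k w))).
apply: (@le_lt_trans _ _ (s (q i) + second_gap t H 1)%:E); last exact: ltry.
apply: limn_einf_le; near=> k.
have k0 : (0 < k)%N by near: k; exists 1%N.
rewrite (@integral_stat (fun j => truncate H k j ^+ 2) k); last 2 first.
- by move=> j; rewrite sqr_ge0.
- by move=> j kj; rewrite truncate_ge// expr0n.
rewrite lee_fin.
have := second_trunc r t0 H0 sH2 (q01 i) k0; rewrite ler_norml => /andP[_].
rewrite lerBlDl => /le_trans; apply; rewrite lerD2l.
have /andP[qi0 qi1] := q01 i.
have g0 : 0 <= second_gap t H k by apply: series_tail_ge0 => //; exact: ltW.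
apply: (@le_trans _ _ (second_gap t H k)); first by rewrite ler_piMl.
rewrite /second_gap /series_tail lerD2l lerN2 -subr_ge0 sub_series_geq// sumr_ge0// => j _.
by apply: abs_coeff_ge0; exact: ltW.
Unshelve. all: by end_near. Qed.

(** The bound holds for truncated H by second_moment_counts and passes to
    the limit by dominated convergence; the dominating function comes from
    Cauchy-Schwarz over the blocks. *)
Lemma block_second_moment :
  (((\sum_i m (q i)) ^+ 2 + \sum_i (s (q i) - m (q i) ^+ 2))%:E <=
   \int[P]_w ((\sum_i error_stat (fun j => - H j) (cnt w i)) ^+ 2)%:E)%E.
Proof.
pose f k w := ((\sum_i error_stat (fun j => - truncate H k j) (cnt w i)) ^+ 2)%:E : \bar R.
pose F w := ((\sum_i error_stat (fun j => - H j) (cnt w i)) ^+ 2)%:E : \bar R.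
pose g w := (\sum_i (n%:R * error_stat (fun j => H j ^+ 2) (cnt w i))%:E)%E : \bar R.
have mf k : measurable_fun setT (f k).
  exact: (measurable_counts e tr (fun x : 'I_n -> nat * nat =>
    ((\sum_i error_stat (fun j => - truncate H k j) (x i)) ^+ 2)%:E)).
have mF : measurable_fun setT F.
  exact: (measurable_counts e tr (fun x : 'I_n -> nat * nat =>
    ((\sum_i error_stat (fun j => - H j) (x i)) ^+ 2)%:E)).
have ig : P.-integrable setT g.
  apply: integrable_sum => // i _; under eq_fun do rewrite EFinM.
  apply: integrableZl => //; apply/integrableP; split; first exact: mstat.
  rewrite (eq_integral (fun w => (error_stat (fun j => H j ^+ 2) (cnt w i))%:E)).
    exact: integral_second_lty.
  by move=> w _; rewrite gee0_abs// lee_fin /error_stat addr_ge0// sqr_ge0.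
have fg k w : (`|f k w| <= g w)%E.
  rewrite gee0_abs ?lee_fin ?sqr_ge0// /f /g sumEFin lee_fin -mulr_sumr.
  have := @sqr_sum_le R _ [set: 'I_n]%SET (fun i => error_stat (fun j => - truncate H k j) (cnt w i)) n.
  have eqT (h : 'I_n -> R) : \sum_(i in [set: 'I_n]%SET) h i = \sum_i h i.
    by apply: eq_bigl => i; rewrite inE.
  rewrite cardsT card_ord !eqT => /(_ (leqnn _)) /le_trans; apply.
  rewrite ler_wpM2l// ler_sum// => i _; rewrite error_stat_sqr ?truncate0//.
  by apply: error_stat_mono => j; rewrite /truncate; case: ifP; rewrite ?expr0n ?sqr_ge0.
have cf w : f ^~ w @ \oo --> F w.
  apply: cvg_near_cst; near=> k; rewrite /f /F; congr ((_ ^+ 2)%:E).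
  apply: eq_bigr => i _; rewrite /error_stat /truncate.
  suff -> : ((cnt w i).1 < k)%N by [].
  have : (\max_i (cnt w i).1 < k)%N by near: k; exists (\max_i (cnt w i).1).+1.
  by apply: leq_ltn_trans; exact: leq_bigmax.
have [_ _ cI] := dominated_convergence measurableT mf mF
  (aeW _ (fun w _ => cf w)) ig (aeW _ (fun w k _ => fg k w)).
have cm i := cvg_mean_trunc (r := r) t0 H0 sH (q01 i).
have cs i := cvg_second_trunc (r := r) t0 H0 sH2 (q01 i).
pose L k := (\sum_i error_mean rate (truncate H k) k (q i)) ^+ 2 +
  \sum_i (error_second_moment rate (truncate H k) k (q i) - error_mean rate (truncate H k) k (q i) ^+ 2).
have cL : L @ \oo --> (\sum_i m (q i)) ^+ 2 + \sum_i (s (q i) - m (q i) ^+ 2).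
  apply: cvgD; first by rewrite !expr2; apply: cvgM; exact: cvg_sumr.
  apply: cvg_sumr => i; apply: cvgB; first exact: cs.
  by rewrite expr2; apply: cvgM.
have cL' : (fun k => (L k)%:E) @ \oo -->
    (((\sum_i m (q i)) ^+ 2 + \sum_i (s (q i) - m (q i) ^+ 2))%:E).
  by apply: cvg_EFin; [exact: nearW|exact: cL].
rewrite -(cvg_lim _ cL')// -[leRHS](cvg_lim _ cI)//.
apply: lee_lim; [by apply/cvg_ex; eexists; exact: cL'|
  by apply/cvg_ex; eexists; exact: cI|].
near=> k.
have [J [iJ _ JL]] := second_moment_counts t0 t0' e tr (truncate0 H0 k) (@truncate_ge R H k).
by apply: (@le_trans _ _ J%:E); [rewrite lee_fin; exact: JL|rewrite -iJ].
Unshelve. all: by end_near. Qed.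

End block_risk.

(** * Bounds on the profiles from block designs *)

Section extremal.
Context (R : realType).
Variables (m s : R -> R) (V x C : R).
Hypothesis V0 : 0 <= V.
Hypothesis m_local : forall p, 0 <= p <= 1 -> `|m p - p * x| <= C * p ^+ 2.
Hypothesis sqr_le : forall p, 0 <= p <= 1 -> m p ^+ 2 <= s p.

(** A lower bound for the risk, divided by the square of the block size, of the
    design with block probabilities p; m and s stand for the first two moments of
    an error contribution. *)
Definition block_bound n (p : 'I_n -> R) : R :=
  (\sum_i m (p i)) ^+ 2 + \sum_i (s (p i) - m (p i) ^+ 2).

(** The total contribution of L.+1 blocks of total probability c depends only on
    the derivative z of f at 0 in the limit. *)
Lemma cvg_rare (f : R -> R) z K c : (forall p, 0 <= p <= 1 -> `|f p - p * z| <= K * p ^+ 2) ->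
  0 <= c <= 1 -> L.+1%:R * f (c / L.+1%:R) @[L --> \oo] --> c * z.
Proof.
move=> f_local c01; have /andP[c0 c1] := c01.
have b (L : nat) : `|L.+1%:R * f (c / L.+1%:R) - c * z| <= K * c ^+ 2 * harmonic L.
  have l0 : 0 < L.+1%:R :> R by rewrite ltr0n.
  have cl : 0 <= c / L.+1%:R <= 1.
    by rewrite divr_ge0//= ler_pdivrMr// mul1r (le_trans c1)// ler1n.
  have -> : L.+1%:R * f (c / L.+1%:R) - c * z = L.+1%:R * (f (c / L.+1%:R) - c / L.+1%:R * z).
    by move: l0; set l := L.+1%:R => l0; field; rewrite gt_eqF.
  rewrite normrM (ger0_norm (ltW l0)).
  apply: (le_trans (ler_wpM2l (ltW l0) (f_local _ cl))).
  rewrite /harmonic/= le_eqVlt; apply/orP; left; apply/eqP.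
  by move: l0; set l := L.+1%:R => l0; field; rewrite gt_eqF.
have ch : (fun L => K * c ^+ 2 * harmonic L) @ \oo --> (0 : R).
  by rewrite -[X in _ --> X](mulr0 (K * c ^+ 2)); apply: cvgMl_tmp; exact: cvg_harmonic.
apply/cvgrPdist_le => eps eps0; near=> L; rewrite distrC (le_trans (b L))//.
by near: L; exact: (cvgr_le _ ch).
Unshelve. all: by end_near. Qed.

Lemma block_bound_cst k q : block_bound (fun _ : 'I_k => q) =
  (k%:R * m q) ^+ 2 + k%:R * (s q - m q ^+ 2).
Proof. by rewrite /block_bound !sumr_const card_ord !mulr_natl. Qed.

(** The number of blocks is k = floor (1 / p), which covers more than half of
    the total mass. *)
Lemma half_cover (p : R) : 0 < p <= 1 -> exists k : nat,
  [/\ (0 < k)%N, k%:R * p <= 1 & 1 < 2 * (k%:R * p)].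
Proof.
move=> /andP[p0 p1]; have ip0 : 0 <= p^-1 by rewrite invr_ge0 ltW.
have /andP[k1 k2] := truncn_itv ip0.
set k := Num.truncn p^-1 in k1 k2; exists k.
have kp : k%:R * p <= 1 by rewrite -ler_pdivlMr// div1r.
have kp' : 1 < k.+1%:R * p by rewrite -ltr_pdivrMr// div1r.
have k0 : (0 < k)%N.
  by rewrite lt0n; apply: contraTneq kp' => ->; rewrite mul1r -leNgt.
split => //; apply: (lt_le_trans kp').
rewrite mulrA ler_wpM2r ?(ltW p0)// -natrM ler_nat mul2n -addnn.
by rewrite -addn1 leq_add2l.
Qed.

(** Since m q ^ 2 <= s q, the variance part of block_bound is nonnegative, and
    k ^ 2 >= k allows to trade the variances for the second moments. *)
Lemma cst_block_bounds k q : (0 < k)%N -> 0 <= q <= 1 ->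
  block_bound (fun _ : 'I_k => q) <= V -> k%:R * `|m q| <= Num.sqrt V /\ k%:R * s q <= V.
Proof.
move=> k0 q01; rewrite block_bound_cst => h.
have sm := sqr_le q01; have k1 : 1 <= k%:R :> R by rewrite ler1n.
have k0' : 0 <= k%:R :> R by exact: ler0n.
split.
  have -> : k%:R * `|m q| = `|k%:R * m q| by rewrite normrM ger0_norm.
  rewrite -sqrtr_sqr ler_wsqrtr//; apply: le_trans h.
  by rewrite lerDl mulr_ge0// subr_ge0.
apply: le_trans h; have : 0 <= (k%:R * (k%:R - 1)) * m q ^+ 2.
  by rewrite mulr_ge0 ?sqr_ge0// mulr_ge0// subr_ge0.
by rewrite exprMn; lra.
Qed.

Lemma subprob_bounds p :
  (forall n (w : 'I_n -> R), (forall i, 0 <= w i <= 1) -> \sum_i w i <= 1 ->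
     block_bound w <= V) ->
  0 < p <= 1 -> `|m p| <= p * (2 * Num.sqrt V) /\ s p <= p * (2 * V).
Proof.
move=> hV p01; have [k [k0 kp kp2]] := half_cover p01.
have /andP[p0 p1] := p01; have p01' : 0 <= p <= 1 by rewrite ltW.
have /(cst_block_bounds k0 p01')[h1 h2] : block_bound (fun _ : 'I_k => p) <= V.
  by apply: hV => //; rewrite sumr_const card_ord mulr_natl in kp *.
have kr : 0 < k%:R :> R by rewrite ltr0n.
have S0 := sqrtr_ge0 V; have s0 := le_trans (sqr_ge0 _) (sqr_le p01').
have a0 := normr_ge0 (m p).
by split; nra.
Qed.

(** The mass p' < 1/2 that the k blocks of probability p leave over is spread
    over rare blocks, whose total mean tends to p' * x. Rare blocks alone show
    |x| <= sqrt V, so that k |m p| <= (1 + p') * sqrt V with k p = 1 - p', and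
    (1 + p') / (1 - p') <= 3. Then k * s p <= V + k * m p ^ 2 gives the constant
    2 + 9 = 11 for the second moment. *)
Lemma prob_bounds p :
  (forall n (w : 'I_n -> R), (forall i, 0 <= w i <= 1) -> \sum_i w i = 1 ->
     block_bound w <= V) ->
  0 < p <= 1 -> `|m p| <= p * (3 * Num.sqrt V) /\ s p <= p * (11 * V).
Proof.
move=> hV p01; have [k [k0 kp kp2]] := half_cover p01.
have /andP[p0 p1] := p01; have p01' : 0 <= p <= 1 by rewrite ltW.
have kr : 1 <= k%:R :> R by rewrite ler1n.
pose p' := 1 - k%:R * p.
have p'01 : 0 <= p' <= 1 by rewrite subr_ge0 kp/= gerBl mulr_ge0// ltW.
have i01 : 0 <= (1 : R) <= 1 by rewrite ler01 lexx.
have rare1 (c : R) (L : nat) : 0 <= c <= 1 -> 0 <= c / L.+1%:R <= 1.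
  move=> /andP[c0 c1]; rewrite divr_ge0//= ler_pdivrMr// mul1r.
  by rewrite (le_trans c1)// ler1n.
have S0 := sqrtr_ge0 V; have SV := sqr_sqrtr V0.
have x2 : `|x| <= Num.sqrt V.
  have cx := cvg_rare m_local i01; rewrite mul1r in cx.
  have cx' : `|L.+1%:R * m (1 / L.+1%:R)| @[L --> \oo] --> `|x| by exact: cvg_norm.
  apply: (cvgr_to_le cx'); apply: nearW => L.
  have : block_bound (fun _ : 'I_L.+1 => 1 / L.+1%:R) <= V.
    apply: hV => [i|]; first exact: rare1.
    by rewrite sumr_const card_ord -[LHS]mulr_natl mul1r divff// pnatr_eq0.
  move=> /(cst_block_bounds (ltn0Sn L) (rare1 _ _ i01))[h _].
  by rewrite normrM ger0_norm.
(* the variances of the rare blocks are nonnegative and are dropped *)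
have mix : (k%:R * m p + p' * x) ^+ 2 + k%:R * (s p - m p ^+ 2) <= V.
  have cx := cvg_rare m_local p'01.
  have c : (k%:R * m p + L.+1%:R * m (p' / L.+1%:R)) ^+ 2 + k%:R * (s p - m p ^+ 2)
      @[L --> \oo] --> (k%:R * m p + p' * x) ^+ 2 + k%:R * (s p - m p ^+ 2).
    apply: cvgD; last exact: cvg_cst.
    by rewrite !expr2; apply: cvgM; apply: cvgD => //; exact: cvg_cst.
  apply: (cvgr_to_le c); apply: nearW => L.
  (* k blocks of probability p and L.+1 rare ones *)
  pose w (i : 'I_(k + L.+1)) := if fintype.split i is inl _ then p else p' / L.+1%:R.
  have sw (h : R -> R) : \sum_i h (w i) = k%:R * h p + L.+1%:R * h (p' / L.+1%:R).
    rewrite big_split_ord/=; congr (_ + _).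
      rewrite (eq_bigr (fun=> h p)); first by rewrite sumr_const card_ord mulr_natl.
      by move=> i _; rewrite /w (unsplitK (inl i)).
    rewrite (eq_bigr (fun=> h (p' / L.+1%:R))).
      by rewrite sumr_const card_ord mulr_natl.
    by move=> i _; rewrite /w (unsplitK (inr i)).
  have w01 i : 0 <= w i <= 1.
    by rewrite /w; case: fintype.split => _ //; exact: rare1.
  have w1 : \sum_i w i = 1.
    by rewrite (sw id)/= [X in _ + X]mulrC divfK ?pnatr_eq0// addrC subrK.
  apply: le_trans (hV _ w w01 w1).
  rewrite /block_bound (sw m) (sw (fun q => s q - m q ^+ 2)).
  rewrite lerD2l lerDl mulr_ge0// subr_ge0; apply: sqr_le; exact: rare1.
have sm := sqr_le p01'.
have m3 : `|m p| <= p * (3 * Num.sqrt V).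
  have h : `|k%:R * m p + p' * x| <= Num.sqrt V.
    rewrite -sqrtr_sqr ler_wsqrtr//; apply: le_trans mix.
    by rewrite lerDl mulr_ge0// subr_ge0.
  have h2 : k%:R * `|m p| <= (1 + p') * Num.sqrt V.
    have -> : k%:R * `|m p| = `|(k%:R * m p + p' * x) - p' * x|.
      by rewrite addrK normrM ger0_norm.
    rewrite (le_trans (ler_normB _ _))// [leRHS]mulrDl mul1r lerD// normrM ger0_norm.
      by rewrite ler_wpM2l//; case/andP: p'01.
    by case/andP: p'01.
  have : (1 + p') * Num.sqrt V <= k%:R * p * (3 * Num.sqrt V).
    by rewrite /p'; nra.
  rewrite -mulrA => h3; have := le_trans h2 h3.
  by rewrite ler_pM2l// ltr0n.
split=> //.
have m9 : m p ^+ 2 <= p ^+ 2 * (9 * V).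
  have -> : p ^+ 2 * (9 * V) = (p * (3 * Num.sqrt V)) ^+ 2.
    by rewrite !exprMn SV; ring.
  by rewrite -[leLHS]real_normK ?num_real// lerXn2r// nnegrE !mulr_ge0// ltW.
have ks : k%:R * s p <= V + k%:R * (p ^+ 2 * (9 * V)).
  have : 0 <= (k%:R * m p + p' * x) ^+ 2 by exact: sqr_ge0.
  have : k%:R * m p ^+ 2 <= k%:R * (p ^+ 2 * (9 * V)) by rewrite ler_wpM2l.
  lra.
have : V <= k%:R * p * (2 * V) by nra.
have : k%:R * (p ^+ 2 * (9 * V)) <= k%:R * (p * (9 * V)).
  rewrite ler_wpM2l// ler_wpM2r ?mulr_ge0//.
  by rewrite expr2 ler_piMl// ltW.
move=> g1 g2.
have : k%:R * s p <= k%:R * (p * (11 * V)) by lra.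
by rewrite ler_pM2l// ltr0n.
Qed.

End extremal.

(** * Summability of the coefficients *)

Section summability.
Context (R : realType) (t : R) (H : nat -> R).
Hypotheses (t0 : 0 < t) (H0 : H 0%N = 0).

Lemma summable_sqr : (\sum_(1 <= i <oo) (H i ^+ 2 * t ^+ i / i`!%:R)%:E < +oo)%E ->
  summable_at (fun i => H i ^+ 2) t.
Proof.
pose u i := H i ^+ 2 * t ^+ i / i`!%:R; move=> hs.
have u0 i : (0 <= (u i)%:E)%E.
  by rewrite lee_fin mulr_ge0 ?invr_ge0// mulr_ge0 ?sqr_ge0// exprn_ge0// ltW.
have t1 : (\sum_(1 <= i <oo) (u i)%:E)%E \is a fin_num.
  by rewrite ge0_fin_numE//; apply: nneseries_ge0 => i _ _.
apply: (@nondecreasing_is_cvgn _ _ ).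
  by apply/nondecreasing_seqP => n; rewrite seriesSr lerDl; apply: abs_coeff_ge0; exact: ltW.
exists (fine (\sum_(1 <= i <oo) (u i)%:E)%E) => _ [n _ <-].
rewrite -lee_fin fineK// /series/= -sumEFin.
case: n => [|n]; first by rewrite big_geq// nneseries_ge0.
rewrite big_nat_recl// /abs_coeff H0 expr0n normr0 !mul0r add0e.
rewrite -(big_add1 _ _ 0 n.+1 xpredT (fun i => (`|H i ^+ 2| * t ^+ i / i`!%:R)%:E)).
apply: le_trans (nneseries_lim_ge n.+1 (fun i _ _ => u0 i)).
by apply: lee_sum => i _; rewrite ger0_norm// sqr_ge0.
Qed.

(** By |h| <= 1 + h ^ 2. *)
Lemma summable_of_sqr : summable_at (fun i => H i ^+ 2) t -> summable_at H t.
Proof.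
move=> s2; apply: (@series_le_cvg _ _ (fun i => exp_coeff t i + abs_coeff (fun i => H i ^+ 2) t i)).
- by move=> i; apply: abs_coeff_ge0; exact: ltW.
- by move=> i; apply: addr_ge0; [exact/exp_coeff_ge0/ltW|apply: abs_coeff_ge0; exact: ltW].
- move=> i; rewrite /abs_coeff /exp_coeff/= -mulrDl ler_wpM2r ?invr_ge0//.
  rewrite -[X in _ <= X + _]mul1r -mulrDl ler_wpM2r ?exprn_ge0//; first exact: ltW.
  rewrite (ger0_norm (sqr_ge0 _)) -(real_normK (num_real (H i))).
  have := normr_ge0 (H i); have := sqr_ge0 (`|H i| - 1); nra.
rewrite (_ : (fun i => _) = exp_coeff t + abs_coeff (fun i => H i ^+ 2) t)// seriesD.
by apply: is_cvgD => //; exact: is_cvg_series_exp_coeff.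
Qed.

End summability.

(** * The functional G in terms of first and second moments *)

Section profiles.
Context (R : realType) (r t : R) (H : nat -> R).
Hypotheses (r0 : 0 < r) (t0 : 0 < t) (H0 : H 0%N = 0).
Hypothesis sH2 : summable_at (fun i => H i ^+ 2) t.
Let sH := summable_of_sqr t0 sH2.

Local Notation m := (mean_profile r t H).
Local Notation s := (second_profile r t H).

Lemma biasE p : 0 < p <= 1 -> bias_profile r t H p = `|m p| / p.
Proof.
move=> /andP[p0 p1]; rewrite /bias_profile gt_eqF// /mean_profile /profile.
rewrite egfN ?(ltW t0) ?(ltW p0)// normrM (ger0_norm (expR_ge0 _)).
by rewrite mulrAC.
Qed.

Lemma varianceE p : 0 < p <= 1 -> variance_profile r t H p = s p / p.
Proof.
move=> /andP[p0 p1]; rewrite /variance_profile gt_eqF// /second_profile /profile.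
by rewrite mulrAC.
Qed.

Let x := t * (r + - H 1%N).
Let y := t * (r + H 1%N ^+ 2).

Lemma mean_local : exists C, forall p, 0 <= p <= 1 -> `|m p - p * x| <= C * p ^+ 2.
Proof.
by apply: profile_local; rewrite ?(ltW r0) ?(ltW t0)// ?H0 ?oppr0//; exact: summable_atN.
Qed.

Lemma second_local : exists C, forall p, 0 <= p <= 1 -> `|s p - p * y| <= C * p ^+ 2.
Proof. by apply: profile_local; rewrite ?(ltW r0) ?(ltW t0)// H0 expr0n. Qed.

Lemma G_fin : (\sum_(1 <= i <oo) (H i ^+ 2 * t ^+ i / i`!%:R)%:E < +oo)%E ->
  G r t H = (Yb r t H + Yv r t H)%E.
Proof. by move=> h; rewrite /G lt_eqF. Qed.

Let bias_ge0 p : 0 <= p <= 1 -> 0 <= bias_profile r t H p.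
Proof.
move=> /andP[p0 p1]; rewrite /bias_profile; case: ifP => _; rewrite mulr_ge0// ?(ltW t0)//.
by rewrite divr_ge0// expR_ge0.
Qed.

Let i01 : 0 <= (1 : R) <= 1. Proof. by rewrite ler01 lexx. Qed.

Lemma bias_sup_ge0 :
  (0 <= ereal_sup [set (bias_profile r t H p)%:E | p in `[0%R, 1%R]])%E.
Proof.
apply: (@le_trans _ _ (bias_profile r t H 1)%:E); first by rewrite lee_fin bias_ge0.
by apply: ereal_sup_ubound; exists 1 => //=; rewrite in_itv/= ler01 lexx.
Qed.

Lemma Yv_ge0 : (0 <= Yv r t H)%E.
Proof.
apply: (@le_trans _ _ (variance_profile r t H 1)%:E); last first.
  by apply: ereal_sup_ubound; exists 1 => //=; rewrite in_itv/= ler01 lexx.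
rewrite lee_fin varianceE ?ltr01 ?lexx// divr1.
apply: le_trans (mean_profile_sqr_le r0 t0 H0 sH sH2 i01); exact: sqr_ge0.
Qed.

(** The values of the profiles at 0 are limits of their values at 1 / L, so
    that bounds on (0, 1] extend to [0, 1]. *)
Lemma G_le (a b : R) : (\sum_(1 <= i <oo) (H i ^+ 2 * t ^+ i / i`!%:R)%:E < +oo)%E ->
  0 <= a ->
  (forall p, 0 < p <= 1 -> `|m p| <= p * a) -> (forall p, 0 < p <= 1 -> s p <= p * b) ->
  (G r t H <= (a ^+ 2 + b)%:E)%E.
Proof.
move=> hs a0 ha hb; rewrite G_fin// EFinD; apply: leeD.
  have ub : (ereal_sup [set (bias_profile r t H p)%:E | p in `[0%R, 1%R]] <= a%:E)%E.
    apply: ge_ereal_sup => _ [p /= + <-]; rewrite in_itv/= lee_fin => /andP[p0 p1].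
    have [p00|pn0] := eqVneq p 0; last first.
      have pp : 0 < p by rewrite lt_neqAle eq_sym pn0.
      by rewrite biasE ?pp// ler_pdivrMr// mulrC ha ?pp.
    have [C hC] := mean_local.
    rewrite p00 /bias_profile eqxx -[X in X * _](ger0_norm (ltW t0)) -normrM.
    have cx := cvg_rare hC i01; rewrite mul1r in cx.
    have cx' : `|L.+1%:R * m (1 / L.+1%:R)| @[L --> \oo] --> `|x| by exact: cvg_norm.
    apply: (cvgr_to_le cx'); apply: nearW => L.
    have l0 : 0 < L.+1%:R :> R by rewrite ltr0n.
    rewrite normrM (ger0_norm (ltW l0)) mulrC -ler_pdivlMr// [a / _]mulrC -[X in X * a]div1r.
    by rewrite ha// divr_gt0//= ler_pdivrMr// mul1r ler1n.
  have := bias_sup_ge0; rewrite /Yb; move: ub.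
  case: (ereal_sup _) => [z| |]//; rewrite !lee_fin => za z0.
  by rewrite -expr2 lerXn2r.
apply: ge_ereal_sup => _ [p /= + <-]; rewrite in_itv/= lee_fin => /andP[p0 p1].
have [p00|pn0] := eqVneq p 0; last first.
  have pp : 0 < p by rewrite lt_neqAle eq_sym pn0.
  by rewrite varianceE ?pp// ler_pdivrMr// mulrC hb ?pp.
have [C hC] := second_local.
rewrite p00 /variance_profile eqxx.
have cx := cvg_rare hC i01; rewrite mul1r in cx.
apply: (cvgr_to_le cx); apply: nearW => L.
have l0 : 0 < L.+1%:R :> R by rewrite ltr0n.
rewrite mulrC -ler_pdivlMr// [b / _]mulrC -[X in X * b]div1r.
by rewrite hb// divr_gt0//= ler_pdivrMr// mul1r ler1n.
Qed.

End profiles.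

(** * The two-sided bounds *)

Section conclusion.
Context (R : realType) (B' : nat) (r t : R) (H : nat -> R).
Hypotheses (r0 : 0 < r) (t0 : 0 < t) (H0 : H 0%N = 0).
Local Notation B := B'.+1.
Let t0' : 0 < r * t. Proof. exact: mulr_gt0. Qed.
Local Notation hseries := (\sum_(1 <= i <oo) (H i ^+ 2 * t ^+ i / i`!%:R)%:E)%E.

Lemma G_pinfty : ~ (hseries < +oo)%E -> G r t H = +oo%E.
Proof.
rewrite /G => h; case: eqP => // hy; exfalso; apply: h.
by rewrite ltey; apply/eqP.
Qed.

Lemma sup_risk_le (admissible : forall S : countType, probability {fset S} R -> Prop) :
  (forall S mu, admissible S mu -> size_le B mu) ->
  (sup_risk admissible t (r * t) H <= (B%:R ^+ 2)%:E * G r t H)%E.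
Proof.
move=> hcls.
have B2 : (0 < (B%:R ^+ 2)%:E :> \bar R)%E by rewrite lte_fin exprn_gt0.
have [hs|/G_pinfty ->] := pselect (hseries < +oo)%E; last by rewrite gt0_muley// leey.
have sH2 := summable_sqr t0 H0 hs; have sH := summable_of_sqr t0 sH2.
rewrite G_fin//.
have b0 := @bias_sup_ge0 _ r t H t0; have c0 := Yv_ge0 r0 t0 H0 sH2.
rewrite /Yb; move: b0 c0.
have ub p : p \in `[0%R, 1%R] -> ((bias_profile r t H p)%:E <=
    ereal_sup [set (bias_profile r t H p)%:E | p in `[0%R, 1%R]])%E.
  by move=> p01; apply: ereal_sup_ubound; exists p.
have uc p : p \in `[0%R, 1%R] -> ((variance_profile r t H p)%:E <= Yv r t H)%E.
  by move=> p01; apply: ereal_sup_ubound; exists p.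
move: ub uc; move: (ereal_sup _) (Yv r t H) => [b| |] [c| |]// ub uc b0 c0;
  rewrite ?addey ?addye ?expe2 ?mulyy ?gt0_muley ?leey//.
rewrite !lee_fin in b0 c0.
apply: ge_ereal_sup => _ [S [mu [d [T [P [e [hmu ->]]]]]]].
have m0 : mean_profile r t H 0 = 0.
  have [C hC] := mean_local r0 t0 H0 sH2.
  by have := hC 0; rewrite lexx ler01 mul0r subr0 expr0n mulr0 normr_le0 => /(_ isT)/eqP.
have s0 : second_profile r t H 0 = 0.
  have [C hC] := second_local r0 t0 H0 sH2.
  by have := hC 0; rewrite lexx ler01 mul0r subr0 expr0n mulr0 normr_le0 => /(_ isT)/eqP.
apply: (@risk_le _ r t H r0 t0 H0 sH sH2 b c _ _ mu _ _ _ e (hcls _ _ hmu)) => // p.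
- move=> /andP[p0 p1]; have [->|pn0] := eqVneq p 0; first by rewrite m0 normr0 mul0r.
  have pp : 0 < p by rewrite lt_neqAle eq_sym pn0.
  have := ub p; rewrite in_itv/= p0 p1 lee_fin => /(_ isT).
  by rewrite biasE ?pp// ler_pdivrMr// mulrC.
- move=> /andP[p0 p1]; have [->|pn0] := eqVneq p 0; first by rewrite s0 mul0r.
  have pp : 0 < p by rewrite lt_neqAle eq_sym pn0.
  have := uc p; rewrite in_itv/= p0 p1 lee_fin => /(_ isT).
  by rewrite varianceE ?pp// ler_pdivrMr// mulrC.
Qed.

Variable admissible : forall S : countType, probability {fset S} R -> Prop.
(** The vectors of block probabilities whose block designs belong to the class
    of measures under consideration. *)
Variable feasible : forall n, ('I_n -> R) -> Prop.
Hypothesis feasible_admissible : forall n (p : 'I_n -> R) mu, feasible p ->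
  size_le B mu -> (\sum_i p i = 1 -> mu [set fset0] = 0%E) ->
  admissible (S := block_species n B') mu.
Hypothesis feasible_le1 : forall n (p : 'I_n -> R), feasible p -> \sum_i p i <= 1.

Lemma sup_risk_ge_block n (p : 'I_n -> R) :
  summable_at (fun i => H i ^+ 2) t -> (forall i, 0 <= p i <= 1) -> feasible p ->
  ((B%:R ^+ 2 * block_bound (mean_profile r t H) (second_profile r t H) p)%:E
    <= sup_risk admissible t (r * t) H)%E.
Proof.
move=> sH2 p01 gp; have sH := summable_of_sqr t0 sH2.
have p0 i : 0 <= p i by case/andP: (p01 i).
have [mu [d [T [P [e [h1 h2 h3 h4 h5]]]]]] :=
  blocks_exist B' p0 (feasible_le1 gp) t0 t0'.
apply: (@le_trans _ _ (risk e H)); last first.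
  apply: ereal_sup_ubound; exists (block_species n B'), mu, d, T, P, e.
  by split => //; exact: feasible_admissible gp h1 h2.
rewrite (risk_block H0 h5) EFinM lee_wpmul2l ?lee_fin ?sqr_ge0//.
have := block_second_moment r0 t0 H0 e h3 sH sH2.
by under eq_bigr do rewrite h4; under [X in _ + X]eq_bigr do rewrite h4.
Qed.

Hypothesis feasible_one : feasible (fun _ : 'I_1 => 1).

(** A single block that is drawn every time has risk at least
    B ^ 2 * exp (- t) times every partial sum of the series. *)
Lemma series_lty_of_sup (c : R) : sup_risk admissible t (r * t) H = c%:E -> (hseries < +oo)%E.
Proof.
move=> supc.
have [mu [d [T [P [e [h1 h2 h3 h4 h5]]]]]] :=
  blocks_exist B' (fun=> ler01) (feasible_le1 feasible_one) t0 t0'.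
have riskc : (risk e H <= c%:E)%E.
  rewrite -supc; apply: ereal_sup_ubound; exists (block_species 1 B'), mu, d, T, P, e.
  by split => //; exact: feasible_admissible feasible_one h1 h2.
pose u i := H i ^+ 2 * t ^+ i / i`!%:R.
have u0 i : 0 <= u i.
  by rewrite mulr_ge0 ?invr_ge0// mulr_ge0 ?sqr_ge0// exprn_ge0// ltW.
have part k : B%:R ^+ 2 * (expR (- t) * \sum_(j < k) u j) <= c.
  rewrite -lee_fin; apply: le_trans riskc.
  rewrite (risk_block H0 h5) EFinM lee_wpmul2l ?lee_fin ?sqr_ge0//.
  pose v j := truncate H k j ^+ 2.
  have v0 j : 0 <= v j by exact: sqr_ge0.
  have vk j : (k <= j)%N -> v j = 0 by move=> kj; rewrite /v truncate_ge// expr0n.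
  apply: (@le_trans _ _ (\int[P]_w (error_stat v (counts e (@blocks_met 1 B') w ord0))%:E)%E).
    rewrite (integral_stat r0 t0 _ _ v0 vk) h4 lee_fin /poisson_mean !mulr1.
    apply: (@le_trans _ _ (\sum_(j < k) poisson_weight t j * v j)).
      rewrite mulr_sumr; apply: ler_sum => j _.
      by rewrite /v /truncate ltn_ord /poisson_weight /u le_eqVlt; apply/orP; left; apply/eqP; ring.
    rewrite lerDr mulr_ge0 ?expR_ge0// subr_ge0.
    by rewrite -[leRHS]expR0 ler_expR oppr_le0 ltW.
  apply: ge0_le_integral => //.
  - by move=> w _; rewrite lee_fin /error_stat addr_ge0.
  - exact: (measurable_counts e (@blocks_met 1 B') (fun x : 'I_1 -> nat * nat =>
      (error_stat v (x ord0))%:E)).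
  - exact: (measurable_counts e (@blocks_met 1 B') (fun x : 'I_1 -> nat * nat =>
      ((\sum_i error_stat (fun j => - H j) (x i)) ^+ 2)%:E)).
  - move=> w _; rewrite lee_fin big_ord1 error_stat_sqr//; apply: error_stat_mono => j.
    by rewrite /v /truncate; case: ifP; rewrite ?expr0n ?sqr_ge0.
apply: (@le_lt_trans _ _ (c / B%:R ^+ 2 / expR (- t))%:E); last exact: ltry.
apply: lime_le; first by apply: is_cvg_nneseries => i _ _; rewrite lee_fin u0.
apply: nearW => k; rewrite sumEFin lee_fin ler_pdivlMr ?expR_gt0// ler_pdivlMr ?exprn_gt0//.
apply: le_trans (part k); rewrite mulrC ler_wpM2l ?sqr_ge0// mulrC ler_wpM2l ?expR_ge0//.
case: k => [|k]; first by rewrite big_geq// big_ord0.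
by rewrite -(big_mkord xpredT u) [leRHS]big_nat_recl// big_add1/= lerDr u0.
Qed.

Lemma sup_risk_ge0 : (0 <= sup_risk admissible t (r * t) H)%E.
Proof.
have [mu [d [T [P [e [h1 h2 h3 h4 h5]]]]]] :=
  blocks_exist B' (fun=> ler01) (feasible_le1 feasible_one) t0 t0'.
apply: (@le_trans _ _ (risk e H)); last first.
  apply: ereal_sup_ubound; exists (block_species 1 B'), mu, d, T, P, e.
  by split => //; exact: feasible_admissible feasible_one h1 h2.
rewrite (risk_block H0 h5) mule_ge0// ?lee_fin ?sqr_ge0//.
by apply: integral_ge0 => w _; rewrite lee_fin sqr_ge0.
Qed.

(** The constants a and b bound the two profiles in terms of the supremum V of
    the risk divided by B ^ 2, whence G <= (a ^ 2 + b) * V. *)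
Lemma sup_risk_ge (a b k : R) : 0 <= a -> a ^+ 2 + b <= k -> 0 < k ->
  (forall V, 0 <= V -> summable_at (fun i => H i ^+ 2) t ->
    (forall n (w : 'I_n -> R), (forall i, 0 <= w i <= 1) -> feasible w ->
      block_bound (mean_profile r t H) (second_profile r t H) w <= V) ->
    forall p, 0 < p <= 1 -> `|mean_profile r t H p| <= p * (a * Num.sqrt V) /\
      second_profile r t H p <= p * (b * V)) ->
  ((B%:R ^+ 2 / k)%:E * G r t H <= sup_risk admissible t (r * t) H)%E.
Proof.
move=> a0 abk k0 bounds.
have B2 : 0 < B%:R ^+ 2 :> R by rewrite exprn_gt0.
move: sup_risk_ge0 (@series_lty_of_sup) (@sup_risk_ge_block).
case: (sup_risk admissible t (r * t) H) => [c|_ _ _|]; [|by rewrite leey|by []].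
rewrite lee_fin => c0 /(_ c erefl) hs hblock.
have sH2 := summable_sqr t0 H0 hs; have sH := summable_of_sqr t0 sH2.
have V0 : 0 <= c / B%:R ^+ 2 by rewrite divr_ge0// ltW.
have hb := bounds _ V0 sH2 _.
have {}hb p : 0 < p <= 1 -> `|mean_profile r t H p| <= p * (a * Num.sqrt (c / B%:R ^+ 2)) /\
      second_profile r t H p <= p * (b * (c / B%:R ^+ 2)).
  apply: hb => n w w01 gw; have := hblock n w sH2 w01 gw.
  by rewrite lee_fin mulrC -ler_pdivlMr.
have := G_le r0 t0 H0 sH2 hs (mulr_ge0 a0 (sqrtr_ge0 _))
  (fun p p01 => (hb p p01).1) (fun p p01 => (hb p p01).2).
rewrite exprMn sqr_sqrtr// -mulrDl => hG.
have Bk : (0 <= (B%:R ^+ 2 / k)%:E :> \bar R)%E by rewrite lee_fin divr_ge0// ltW.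
apply: (le_trans (lee_wpmul2l Bk hG)); rewrite -EFinM lee_fin.
rewrite [leLHS](_ : _ = c * ((a ^+ 2 + b) / k)).
  by rewrite ler_piMr// ler_pdivrMr// mul1r.
by field; rewrite !gt_eqF.
Qed.

End conclusion.

Theorem theorem19 (R : realType) (B : nat) (r t : R) (H : nat -> R)
    (hB : (1 <= B)%N) (hr : (0 < r)%R) (ht : (0 < t)%R) (hH0 : H 0%N = 0%R) :
  [/\ ((B%:R ^+ 2 / 6%:R)%:E * G r t H
         <= sup_risk (@size_le B R) t (r * t)%R H)%E,
      (sup_risk (@size_le B R) t (r * t)%R H
         <= (B%:R ^+ 2)%:E * G r t H)%E,
      ((B%:R ^+ 2 / 34%:R)%:E * G r t H
         <= sup_risk (@size_ge1_le B R) t (r * t)%R H)%E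
    & (sup_risk (@size_ge1_le B R) t (r * t)%R H
         <= (B%:R ^+ 2)%:E * G r t H)%E].
Proof.
case: B hB => // B _; split.
- pose feasible n (p : 'I_n -> R) := \sum_i p i <= 1.
  apply: (@sup_risk_ge _ B r t H hr ht hH0 (@size_le B.+1 R) feasible _ _ _ 2 2 6%:R) => //.
  + by rewrite /feasible big_ord1.
  + by rewrite -natrX -natrD ler_nat.
  + move=> V V0 sH2 hV p p01.
    by apply: (subprob_bounds (mean_profile_sqr_le hr ht hH0 (summable_of_sqr ht sH2) sH2)).
- by apply: sup_risk_le.
- pose feasible n (p : 'I_n -> R) := \sum_i p i = 1.
  apply: (@sup_risk_ge _ B r t H hr ht hH0 (@size_ge1_le B.+1 R) feasible _ _ _ 3 11 34%:R) => //.
  + by move=> n p mu gp hmu h0; split => //; exact: h0.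
  + by move=> n p ->.
  + by rewrite /feasible big_ord1.
  + by rewrite -natrX -natrD ler_nat.
  + move=> V V0 sH2 hV p p01; have [C hC] := mean_local hr ht hH0 sH2.
    by apply: (prob_bounds V0 hC (mean_profile_sqr_le hr ht hH0 (summable_of_sqr ht sH2) sH2)).
- by apply: sup_risk_le => // S mu [].
Qed.
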